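(* Let $X$ be a set of $n\ge 2$ points in sufficiently general position in $\mathbb{P}^1\times\mathbb{P}^1$, and let $(i,i')$ be a minimal element (with respect to $\preceq$) of $\operatorname{reg}(S/I_X)$ with $i\le i'$. Then the virtual resolution of the pair $(S/I_X,(i,i'))$ has length two if either of the following holds: (a) $i(i'+2)\le n$; or (b) $i(i'+2)>n$, $\;-3n+3ii'+4i+i'\le 0$, and $\;3n-3ii'-2i-2i'\ge 0$.
   Context: Let $k$ be an algebraically closed field of arbitrary characteristic and $S=k[x_0,x_1,y_0,y_1]$ the Cox ring of $\mathbb{P}^1\times\mathbb{P}^1$, $\mathbb{Z}^2$-graded by $\deg x_j=(1,0)$, $\deg y_j=(0,1)$. The irrelevant ideal is $B=\langle x_0,x_1\rangle\cap\langle y_0,y_1\rangle$. $\mathbb{N}$ includes $0$. On $\mathbb{Z}^2$, $(i,i')\preceq(j,j')$ means $i\le j$ and $i'\le j'$. For a finite set of points $X\subseteq\mathbb{P}^1\times\mathbb{P}^1$, $I_X\subseteq S$ is the bihomogeneous ideal of forms vanishing on $X$ (it is $B$-saturated). Hilbert function and differences: $H_X(i,i')=\dim_k (S/I_X)_{(i,i')}$ for $(i,i')\in\mathbb{N}^2$; write $m_{i,i'}=H_X(i,i')$, $c_{i,i'}=m_{i,i'}+m_{i-1,i'-1}-m_{i,i'-1}-m_{i-1,i'}$, and $d_{i,i'}=c_{i,i'}+c_{i-1,i'-1}-c_{i,i'-1}-c_{i-1,i'}$, entries with a negative index being $0$. The matrix $\Delta^2H_X=(d_{i,i'})$ is the second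 difference function. $X$ has a generic Hilbert function if $H_X(i,i')=\min\{|X|,(i+1)(i'+1)\}$ for all $(i,i')\in\mathbb{N}^2$. Betti numbers: $\beta_{p,(r,r')}$ is the number of summands $S(-r,-r')$ in homological degree $p$ of the $\mathbb{Z}^2$-graded minimal free resolution of $S/I_X$. Sufficiently general position: by a known theorem of Giuffrida, Maggioni and Ragusa, for each $n\ge1$ there is a dense open subset $U\subseteq(\mathbb{P}^1\times\mathbb{P}^1)^n$ such that for every $(P_1,\dots,P_n)\in U$ the set $X=\{P_1,\dots,P_n\}$ satisfies: (1) $X$ has a generic Hilbert function; (2) the nonzero $\beta_{1,(r,r')}$ are precisely given by $\beta_{1,(r,r')}=-d_{r,r'}$ for the entries $d_{r,r'}<0$ such that either $d_{r,s'}>0$ for some $s'>r'$ or $d_{s,r'}>0$ for some $s>r$. A set $X$ of $n$ points $P_1,\dots,P_n$ is in sufficiently general position if $(P_1,\dots,P_n)\in U$. Multigraded regularity: a $\mathbb{Z}^2$-graded $S$-module $M$ is $r$-regular, $r\in\mathbb{Z}^2$, if (1) $H^j_B(M)_p=0$ for all $j\ge1$ and all $p\in\bigcup(r-\lambda+\mathbb{N}^2)$, the union over $\lambda=(\lambda_1,\lambda_2)\in\mathbb{N}^2$ with $\lambda_1+\lambda_2=j-1$; and (2) $H^0_B(M)_p=0$ for all $p\in(r+(1,0)+\mathbb{N}^2)\cup(r+(0,1)+\mathbb{N}^2)$. Set $\operatorname{reg}(M)=\{r\in\mathbb{Z}^2: M\text{ is } r\text{-regular}\}$. Virtual resolution of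 a pair: for $(i,i')\in\operatorname{reg}(S/I_X)$, the virtual resolution of the pair $(S/I_X,(i,i'))$ is the subcomplex of the $\mathbb{Z}^2$-graded minimal free resolution of $S/I_X$ consisting of all summands $S(-a,-a')$ with $(a,a')\preceq(i+1,i'+1)$. The length of a complex $0\leftarrow F_0\leftarrow F_1\leftarrow\cdots$ is the largest $p$ with $F_p\ne0$. *)

(* Defs.v *)
From HB Require Import structures.
From mathcomp Require Import all_boot all_order all_algebra.
From mathcomp Require Import generic_quotient ring_quotient finmap mpoly.
From Stdlib Require Import ClassicalEpsilon.

Set Implicit Arguments.
Unset Strict Implicit.
Unset Printing Implicit Defensive.

Import GRing.Theory Num.Theory.

Local Open Scope ring_scope.

(* The variables of the Cox ring are ordered x_0, x_1, y_0, y_1. *)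
Notation cox k := {mpoly k[4]}.


Definition preceq (r s : int * int) : bool := (r.1 <= s.1) && (r.2 <= s.2).

(* Arbitrary integer bidegrees are allowed; in a bidegree with a negative
   coordinate 0 is the only bihomogeneous polynomial. *)
Definition bideg (m : 'X_{1..4}) : int * int :=
  ((m 0%R + m 1%R)%:Z, (m 2%:R + m 3%:R)%:Z).

Section Bihomogeneous.
Variable k : fieldType.
Implicit Types (f g : cox k) (r s : int * int).

Definition bihomog r f : Prop := forall m, m \in msupp f -> bideg m = r.

Definition bipart r f : cox k :=
  \sum_(m <- msupp f | bideg m == r) f@_m *: 'X_[m].

Lemma bipartE r f m : (bipart r f)@_m = if bideg m == r then f@_m else 0.
Proof.
rewrite /bipart raddf_sum /=.
under eq_bigr do rewrite mcoeffZ mcoeffX.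
have [mf|mf] := boolP (m \in msupp f); last first.
  rewrite (memN_msupp_eq0 mf) if_same big_seq_cond big1 // => m' /andP[m'f _].
  by have [e|] := eqVneq m' m; [rewrite -e m'f in mf | rewrite mulr0].
rewrite big_mkcond (bigD1_seq m) ?msupp_uniq //= eqxx mulr1 big1 ?addr0 //.
by move=> m' /negPf ne; case: ifP => // _; rewrite ne mulr0.
Qed.

Lemma bipart_is_zmod_morphism r : zmod_morphism (bipart r).
Proof.
move=> f g; apply/mpolyP => m; rewrite mcoeffB !bipartE mcoeffB.
by case: ifP; rewrite ?subr0.
Qed.

HB.instance Definition _ r :=
  GRing.isZmodMorphism.Build _ _ (bipart r) (bipart_is_zmod_morphism r).

Lemma bipart_homog r f : bihomog r (bipart r f).
Proof.
move=> m; rewrite mcoeff_msupp bipartE; case: (bideg m =P r) => //.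
by rewrite eqxx.
Qed.

Lemma bipart_id r f : bihomog r f -> bipart r f = f.
Proof.
move=> hf; apply/mpolyP => m; rewrite bipartE.
have [//|ne] := eqVneq (bideg m) r; apply/esym/memN_msupp_eq0.
by apply: contraNN ne => /hf ->.
Qed.

Lemma bipart_ne r s f : bihomog r f -> s != r -> bipart s f = 0.
Proof.
move=> hf ne; apply/mpolyP => m; rewrite bipartE mcoeff0.
have [e|//] := eqVneq (bideg m) s; apply/memN_msupp_eq0.
by apply: contraNN ne => /hf <-; rewrite e.
Qed.

Lemma bihomog0 r : bihomog r 0.
Proof. by move=> m; rewrite msupp0 in_nil. Qed.

Lemma bihomogB r f g : bihomog r f -> bihomog r g -> bihomog r (f - g).
Proof. by move=> hf hg; rewrite -(bipart_id hf) -(bipart_id hg) -raddfB; exact: bipart_homog. Qed.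

Lemma bidegD (m m' : 'X_{1..4}) : bideg (m + m')%MM = bideg m + bideg m'.
Proof. by rewrite /bideg !mnmDE; congr pair; rewrite -PoszD addnACA. Qed.

Lemma bihomogM r s f g : bihomog r f -> bihomog s g -> bihomog (r + s) (f * g).
Proof.
move=> hf hg m /msuppM_le/allpairsP[[m1 m2] /= [m1f m2g ->]].
by rewrite bidegD (hf _ m1f) (hg _ m2g).
Qed.

Lemma bipart_sum f :
  f = \sum_(r <- undup [seq bideg m | m <- msupp f]) bipart r f.
Proof.
apply/mpolyP => m; rewrite raddf_sum /=.
under eq_bigr do rewrite bipartE.
have [mf|mf] := boolP (m \in msupp f); last first.
  by rewrite (memN_msupp_eq0 mf) big1 // => r _; rewrite if_same.
rewrite (bigD1_seq (bideg m)) ?undup_uniq ?mem_undup ?map_f //= eqxx.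
by rewrite big1 ?addr0 // => r /negPf; rewrite eq_sym => ->.
Qed.

Lemma bipartM r f g : bipart r (f * g) =
  \sum_(s <- undup [seq bideg m | m <- msupp f]) bipart s f * bipart (r - s) g.
Proof.
rewrite {1}[f]bipart_sum mulr_suml raddf_sum; apply: eq_bigr => s _.
rewrite {1}[g]bipart_sum mulr_sumr raddf_sum /=.
have [rs|rs] := boolP (r - s \in undup [seq bideg m | m <- msupp g]).
  rewrite (bigD1_seq (r - s)) ?undup_uniq //= big1 ?addr0.
    apply: bipart_id; have {1}-> : r = s + (r - s) by rewrite addrC subrK.
    by apply: bihomogM; exact: bipart_homog.
  move=> t ne; apply: (bipart_ne (r := s + t)).
    by apply: bihomogM; exact: bipart_homog.
  by rewrite addrC -subr_eq eq_sym.
have -> : bipart (r - s) g = 0.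
  apply/mpolyP => m; rewrite bipartE mcoeff0; case: eqP => // e.
  apply/memN_msupp_eq0; apply: contraNN rs => mg.
  by rewrite mem_undup -e map_f.
rewrite mulr0 big1_seq // => t /andP[_ tg].
apply: (bipart_ne (r := s + t)).
  by apply: bihomogM; exact: bipart_homog.
by rewrite addrC -subr_eq; apply: contraNN rs => /eqP ->.
Qed.

End Bihomogeneous.

Record gmodule (k : fieldType) := GModule {
  gm_sort :> lmodType (cox k);
  gm_piece : int * int -> gm_sort -> Prop;
  gm_piece0 : forall r, gm_piece r 0;
  gm_pieceB : forall r u v, gm_piece r u -> gm_piece r v -> gm_piece r (u - v);
  gm_pieceZ : forall r s f u,
    bihomog r f -> gm_piece s u -> gm_piece (r + s) (f *: u);
  gm_span : forall u, exists (s : seq (int * int)) (c : int * int -> gm_sort),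
    (forall r, gm_piece r (c r)) /\ u = \sum_(r <- s) c r;
  gm_direct : forall (s : seq (int * int)) (c : int * int -> gm_sort),
    uniq s -> (forall r, gm_piece r (c r)) -> \sum_(r <- s) c r = 0 ->
    forall r, r \in s -> c r = 0
}.

Section GradedDimension.
Variables (k : fieldType) (M : gmodule k) (r : int * int).

Definition piece_has_dim (d : nat) : Prop :=
  exists b : 'I_d -> M, (forall a, gm_piece r (b a)) /\
    (forall u, gm_piece r u ->
       exists! c : 'rV[k]_d, u = \sum_a (c 0 a)%:MP *: b a).

(* The value is meaningful for finite-dimensional pieces only. *)
Definition piece_dim : nat := epsilon (inhabits 0%N) piece_has_dim.

End GradedDimension.

Record bihideal (k : fieldType) := BihIdeal {
  bih_mem :> cox k -> bool;
  bih_zmod : zmod_closed (bih_mem : {pred cox k});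
  bih_mul : forall f g, bih_mem g -> bih_mem (f * g);
  bih_part : forall r f, bih_mem f -> bih_mem (bipart r f)
}.

HB.instance Definition _ (k : fieldType) (I : bihideal k) :=
  GRing.isZmodClosed.Build (cox k) (bih_mem I) (bih_zmod I).

Section QuotientModule.
Local Open Scope quotient_scope.
Variables (k : fieldType) (I : bihideal k).

Definition bih_closed : zmodClosed (cox k) :=
  GRing.ZmodClosed.clone (cox k) (bih_mem I) _.

Definition quotmod : Type := Quotient.quot bih_closed.
HB.instance Definition _ := GRing.Zmodule.on quotmod.
HB.instance Definition _ := EqQuotient.on quotmod.

Definition qclass (f : cox k) : quotmod := \pi_quotmod f.

Lemma qclassB : {morph qclass : f g / f - g}.
Proof. exact: (raddfB (\pi_(Quotient.quot bih_closed))). Qed.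

HB.instance Definition _ :=
  GRing.isZmodMorphism.Build (cox k) quotmod qclass qclassB.

Lemma qclass_eq0 f : (qclass f == 0) = bih_mem I f.
Proof.
rewrite -(raddf0 qclass); have := Quotient.idealrBE bih_closed f 0.
by rewrite subr0 => <-.
Qed.

Lemma qclassP (u : quotmod) : {f | u = qclass f}.
Proof. by exists (repr u); rewrite /qclass reprK. Qed.

Definition qscale (f : cox k) (u : quotmod) : quotmod := qclass (f * repr u).

Lemma qscaleE f g : qscale f (qclass g) = qclass (f * g).
Proof.
apply/eqP; rewrite -subr_eq0 -raddfB qclass_eq0 -mulrBr; apply: bih_mul.
by rewrite -qclass_eq0 raddfB /= {1}/qclass reprK subrr.
Qed.

Fact qscaleA f g u : qscale f (qscale g u) = qscale (f * g) u.
Proof. by case: (qclassP u) => h ->; rewrite !qscaleE mulrA. Qed.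

Fact qscale1 : left_id 1 qscale.
Proof. by move=> u; case: (qclassP u) => h ->; rewrite qscaleE mul1r. Qed.

Fact qscaleDr : right_distributive qscale +%R.
Proof.
move=> f u v; case: (qclassP u) => g ->; case: (qclassP v) => h ->.
by rewrite -raddfD !qscaleE mulrDr raddfD.
Qed.

Fact qscaleDl u : {morph qscale^~ u : f g / f + g}.
Proof.
by move=> f g; case: (qclassP u) => h ->; rewrite !qscaleE mulrDl raddfD.
Qed.

HB.instance Definition _ := GRing.Zmodule_isLmodule.Build (cox k) quotmod
  qscaleA qscale1 qscaleDr qscaleDl.

Definition qpiece r (u : quotmod) : Prop :=
  exists2 f, bihomog r f & u = qclass f.

Fact qpiece0 r : qpiece r 0.
Proof. by exists 0; [exact: bihomog0 | rewrite raddf0]. Qed.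

Fact qpieceB r u v : qpiece r u -> qpiece r v -> qpiece r (u - v).
Proof.
move=> [f hf ->] [g hg ->]; exists (f - g); last by rewrite raddfB.
exact: bihomogB.
Qed.

Fact qpieceZ r s f (u : quotmod) :
  bihomog r f -> qpiece s u -> qpiece (r + s) (f *: u).
Proof.
move=> hf [g hg ->]; exists (f * g); first exact: bihomogM.
exact: qscaleE.
Qed.

Fact qpiece_span (u : quotmod) :
  exists (s : seq (int * int)) (c : int * int -> quotmod),
    (forall r, qpiece r (c r)) /\ u = \sum_(r <- s) c r.
Proof.
case: (qclassP u) => f ->.
exists (undup [seq bideg m | m <- msupp f]), (fun r => qclass (bipart r f)).
split; first by move=> r; exists (bipart r f); first exact: bipart_homog.
by rewrite {1}[f]bipart_sum raddf_sum.
Qed.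

Fact qpiece_direct (s : seq (int * int)) (c : int * int -> quotmod) :
  uniq s -> (forall r, qpiece r (c r)) -> \sum_(r <- s) c r = 0 ->
  forall r, r \in s -> c r = 0.
Proof.
move=> us hc; pose g r := bipart r (repr (c r)).
have gE r : exists2 f, bihomog r f & c r = qclass f by exact: hc.
have cE r : c r = qclass (g r).
  have [f hf e] := gE r; apply/eqP; rewrite {1}e -subr_eq0 -raddfB qclass_eq0.
  rewrite /g -{1}(bipart_id hf) -raddfB; apply: bih_part.
  by rewrite -qclass_eq0 raddfB /= -e /qclass reprK subrr.
under eq_bigr do rewrite cE.
rewrite -raddf_sum => /eqP; rewrite qclass_eq0 => h r rs.
apply/eqP; rewrite cE qclass_eq0.
have := bih_part r h; rewrite raddf_sum /= (bigD1_seq r) //= big1 => [|t tr].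
  by rewrite addr0 bipart_id //; exact: bipart_homog.
by apply: (@bipart_ne _ t); [exact: bipart_homog | rewrite eq_sym].
Qed.

Definition quotient_module : gmodule k :=
  GModule qpiece0 qpieceB qpieceZ qpiece_span qpiece_direct.

End QuotientModule.

Definition P1 (k : fieldType) := {L : {vspace 'rV[k]_2} | \dim L == 1%N}.
Definition P1xP1 (k : fieldType) := (P1 k * P1 k)%type.

HB.instance Definition _ (k : fieldType) := Choice.on (P1 k).
HB.instance Definition _ (k : fieldType) := Choice.on (P1xP1 k).

(* A choice of homogeneous coordinates; they are only ever substituted into
   (multi)homogeneous forms, whose vanishing does not depend on the choice. *)
Definition hcoord (k : fieldType) (P : P1xP1 k) : 'rV[k]_(2 + 2) :=
  row_mx (vpick (val P.1)) (vpick (val P.2)).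

Definition eval_at (k : fieldType) (P : P1xP1 k) (f : cox k) : k :=
  f.@[fun a : 'I_4 => hcoord P 0 a].

Section IdealOfPoints.
Variables (k : fieldType) (X : {fset P1xP1 k}).

Definition vanishing (f : cox k) : bool :=
  all (fun r => all (fun P => eval_at P (bipart r f) == 0) X)
    [seq bideg m | m <- msupp f].

Lemma vanishingP f : reflect
  (forall r P, P \in X -> eval_at P (bipart r f) = 0) (vanishing f).
Proof.
apply: (iffP allP) => [h r P PX | h r _].
  have [rf|rf] := boolP (r \in [seq bideg m | m <- msupp f]).
    by apply/eqP; move: P PX; apply/allP; exact: h.
  have -> : bipart r f = 0; last by rewrite /eval_at meval0.
  apply/mpolyP => m; rewrite bipartE mcoeff0; case: eqP => // e.
  by apply/memN_msupp_eq0; apply: contraNN rf => mf; rewrite -e map_f.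
by apply/allP => P PX; apply/eqP/h.
Qed.

Fact vanishing_zmod : zmod_closed (vanishing : {pred cox k}).
Proof.
split; first by apply/vanishingP => r P _; rewrite raddf0 /eval_at meval0.
move=> f g /vanishingP hf /vanishingP hg; apply/vanishingP => r P PX.
by rewrite raddfB /eval_at mevalB [X in X - _]hf // [X in _ - X]hg // subr0.
Qed.

Fact vanishing_mul f g : vanishing g -> vanishing (f * g).
Proof.
move=> /vanishingP hg; apply/vanishingP => r P PX.
rewrite bipartM /eval_at raddf_sum /= big1 // => s _.
by rewrite mevalM [X in _ * X]hg // mulr0.
Qed.

Fact vanishing_part r f : vanishing f -> vanishing (bipart r f).
Proof.
move=> /vanishingP hf; apply/vanishingP => s P PX.
have [->|ne] := eqVneq s r.
  by rewrite bipart_id ?hf //; exact: bipart_homog.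
by rewrite (bipart_ne (@bipart_homog k r f) ne) /eval_at meval0.
Qed.

Definition ideal_of_points : bihideal k :=
  BihIdeal vanishing_zmod vanishing_mul vanishing_part.

Definition coordinate_module : gmodule k := quotient_module ideal_of_points.

Definition hilbert (i i' : nat) : nat :=
  piece_dim coordinate_module (i%:Z, i'%:Z).

Definition generic_hilbert : Prop :=
  forall i i' : nat, hilbert i i' = minn #|` X|%fset (i.+1 * i'.+1).

Definition hilbert_entry (i i' : int) : int :=
  match i, i' with Posz a, Posz a' => (hilbert a a')%:Z | _, _ => 0 end.

Definition difference (h : int -> int -> int) (i i' : int) : int :=
  h i i' + h (i - 1) (i' - 1) - h i (i' - 1) - h (i - 1) i'.

Definition hilbert_diff2 : int -> int -> int :=
  difference (difference hilbert_entry).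

End IdealOfPoints.

(* In homological degree p the module is the direct sum of the S(-fc_shift a),
   viewed as row vectors; the map from degree p.+1 to degree p is
   v |-> v *m fc_diff p. *)
Record free_complex (k : fieldType) := FreeComplex {
  fc_rank : nat -> nat;
  fc_shift : forall p, 'I_(fc_rank p) -> int * int;
  fc_diff : forall p, 'M[cox k]_(fc_rank p.+1, fc_rank p);
  fc_homog : forall p a b,
    bihomog (fc_shift a - fc_shift b) (fc_diff p a b);
  fc_dd : forall p, fc_diff p.+1 *m fc_diff p = 0
}.

Definition minimal_free_resolution (k : fieldType) (M : gmodule k)
    (F : free_complex k) : Prop :=
  (exists e : 'I_(fc_rank F 0) -> M,
     [/\ forall a, gm_piece (fc_shift a) (e a),
         forall u, exists v : 'rV[cox k]_(fc_rank F 0), u = \sum_a v 0 a *: e a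
       & forall v : 'rV[cox k]_(fc_rank F 0),
           \sum_a v 0 a *: e a = 0 <-> exists w, v = w *m fc_diff F 0]) /\
  (forall p (v : 'rV[cox k]_(fc_rank F p.+1)),
     v *m fc_diff F p = 0 -> exists w, v = w *m fc_diff F p.+1) /\
  (* the entries lie in the ideal <x_0, x_1, y_0, y_1> *)
  (forall p a b, (fc_diff F p a b)@_0%MM = 0).

Definition betti (k : fieldType) (F : free_complex k) (p : nat)
    (r : int * int) : nat :=
  #|[pred a : 'I_(fc_rank F p) | fc_shift a == r]|.

Definition complex_length (k : fieldType) (F : free_complex k) (l : nat) : Prop :=
  (0 < fc_rank F l)%N /\ (forall p, (l < p)%N -> fc_rank F p = 0%N).

Section VirtualResolution.
Variables (k : fieldType) (F : free_complex k) (r : int * int).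

Definition kept p : pred 'I_(fc_rank F p) :=
  [pred a | preceq (fc_shift a) (r + (1, 1))].
Arguments kept : clear implicits.

Definition vr_shift p (a : 'I_#|kept p|) : int * int := fc_shift (enum_val a).

Definition vr_diff p : 'M[cox k]_(#|kept p.+1|, #|kept p|) :=
  mxsub enum_val enum_val (fc_diff F p).

Fact vr_homog p a b : bihomog (vr_shift a - vr_shift b) (vr_diff p a b).
Proof. by rewrite mxE; exact: fc_homog. Qed.

Lemma kept_closed p a b :
  a \in kept p.+1 -> b \notin kept p -> fc_diff F p a b = 0.
Proof.
move=> ha hb; apply/eqP; apply: contraNT hb; rewrite -msupp_eq0.
case e : (msupp _) => [//|m s] _.
have mD : m \in msupp (fc_diff F p a b) by rewrite e mem_head.
move: ha; rewrite !inE /preceq => /andP[h1 h2].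
have /= := fc_homog mD.
case: (fc_shift a) (fc_shift b) h1 h2 => [a1 a2] [b1 b2] /= h1 h2 [e1 e2].
apply/andP; split.
  by apply: Order.POrderTheory.le_trans h1; rewrite -subr_ge0 -e1.
by apply: Order.POrderTheory.le_trans h2; rewrite -subr_ge0 -e2.
Qed.

Fact vr_dd p : vr_diff p.+1 *m vr_diff p = 0.
Proof.
apply/matrixP => a c; have := congr1 (fun A : 'M_(_, _) => A (enum_val a) (enum_val c)) (fc_dd F p).
rewrite !mxE => e; rewrite -[RHS]e (bigID (mem (kept p.+1))) /=.
rewrite [X in _ = _ + X]big1 => [|b hb]; last first.
  by rewrite (kept_closed (enum_valP a) hb) mul0r.
rewrite addr0 [RHS]big_enum_val; by apply: eq_bigr => b _; rewrite !mxE.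
Qed.

Definition virtual_resolution : free_complex k := FreeComplex vr_homog vr_dd.

End VirtualResolution.

Section Regularity.
Variables (k : fieldType) (M : gmodule k).

(* The four products x_a y_b generate B; local cohomology is the cohomology of
   the Cech complex on them. *)
Definition Bgen (a : 'I_4) : cox k :=
  tnth [tuple 'X_0%R * 'X_2%:R; 'X_0%R * 'X_3%:R;
              'X_1%R * 'X_2%:R; 'X_1%R * 'X_3%:R] a.

Definition Bprod (A : {set 'I_4}) : cox k := \prod_(a in A) Bgen a.

(* A Cech cochain is given by numerators u and a common exponent t: its
   component in the localization of M at Bprod A is u A / Bprod A ^+ t. *)
Definition cochain := {set 'I_4} -> M.

Definition cochain_homog (j t : nat) (p : int * int) (u : cochain) : Prop :=
  forall A : {set 'I_4}, #|A| = j ->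
    gm_piece (p + ((t * #|A|)%:Z, (t * #|A|)%:Z)) (u A).

(* u / Bprod A ^+ t = v / Bprod A ^+ s in the localization of M at Bprod A *)
Definition frac_eq (A : {set 'I_4}) (t : nat) (u : M) (s : nat) (v : M) : Prop :=
  exists N : nat, Bprod A ^+ N *: (Bprod A ^+ s *: u - Bprod A ^+ t *: v) = 0.

(* Numerators, for the same exponent t, of the Cech coboundary:
   u / Bprod (A :\ a) ^+ t = (Bgen a ^+ t *: u) / Bprod A ^+ t. *)
Definition coboundary (t : nat) (u : cochain) : cochain := fun A =>
  \sum_(a in A) ((-1) ^+ #|[set b in A | (b < a)%N]| * Bgen a ^+ t) *: u (A :\ a).

Definition local_cohomology_vanishes (j : nat) (p : int * int) : Prop :=
  forall (t : nat) (u : cochain), cochain_homog j t p u ->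
    (forall A : {set 'I_4}, #|A| = j.+1 -> frac_eq A t (coboundary t u A) 0 0) ->
    exists (s : nat) (v : cochain),
      (forall i, j = i.+1 -> cochain_homog i s p v) /\
      (forall A : {set 'I_4}, #|A| = j -> frac_eq A t (u A) s (coboundary s v A)).

Definition regular (r : int * int) : Prop :=
  (forall (j l1 l2 q1 q2 : nat), (1 <= j)%N -> (l1 + l2)%N = j.-1 ->
     local_cohomology_vanishes j (r - (l1%:Z, l2%:Z) + (q1%:Z, q2%:Z))) /\
  (forall q1 q2 : nat,
     local_cohomology_vanishes 0 (r + (1, 0) + (q1%:Z, q2%:Z)) /\
     local_cohomology_vanishes 0 (r + (0, 1) + (q1%:Z, q2%:Z))).

Definition minimal_regular (r : int * int) : Prop :=
  regular r /\ (forall s, regular s -> preceq s r -> s = r).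

End Regularity.

Section GeneralPosition.
Variables (k : fieldType) (n : nat).
Implicit Types (t : n.-tuple (P1xP1 k)) (U : n.-tuple (P1xP1 k) -> Prop).

(* The l-th group of variables x_0, x_1, y_0, y_1 has the indices
   mxvec_index l c for c : 'I_4. *)
Definition multihomog (g : {mpoly k[n * 4]}) : Prop :=
  exists d d' : 'I_n -> nat, forall m, m \in msupp g -> forall l : 'I_n,
    let e (c : 'I_4) := m (mxvec_index l c) in
    (e 0%R + e 1%R)%N = d l /\ (e 2%:R + e 3%:R)%N = d' l.

Definition eval_tuple t (g : {mpoly k[n * 4]}) : k :=
  g.@[fun a => mxvec (\matrix_(l < n, c < 4) hcoord (tnth t l) 0 c) 0 a].

Definition zariski_open U : Prop :=
  exists2 T : {mpoly k[n * 4]} -> Prop, (forall g, T g -> multihomog g) &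
    forall t, U t <-> exists2 g, T g & eval_tuple t g != 0.

Definition zariski_dense U : Prop :=
  forall V : n.-tuple (P1xP1 k) -> Prop, zariski_open V -> (exists t, V t) ->
    exists2 t, V t & U t.

End GeneralPosition.

Section SufficientlyGeneral.
Variable k : fieldType.

Definition generator_entry (X : {fset P1xP1 k}) (r r' : int) : Prop :=
  let d := hilbert_diff2 X in
  d r r' < 0 /\
  ((exists2 s', r' < s' & 0 < d r s') \/ (exists2 s, r < s & 0 < d s r')).

Definition generic_generators (X : {fset P1xP1 k}) : Prop :=
  forall F, minimal_free_resolution (coordinate_module X) F ->
  forall r r' : int,
    (generator_entry X r r' ->
       (betti F 1 (r, r'))%:Z = - hilbert_diff2 X r r') /\
    (~ generator_entry X r r' -> betti F 1 (r, r') = 0%N).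

Definition point_set n (t : n.-tuple (P1xP1 k)) : {fset P1xP1 k} :=
  [fset P in tval t]%fset.

(* The properties of the dense open subset supplied by the theorem of
   Giuffrida, Maggioni and Ragusa. *)
Definition gmr_locus n (U : n.-tuple (P1xP1 k) -> Prop) : Prop :=
  [/\ zariski_open U, zariski_dense U
    & forall t, U t ->
        generic_hilbert (point_set t) /\ generic_generators (point_set t)].

End SufficientlyGeneral.

(* Main.v *)
From HB Require Import structures.
Require Import Defs.
From mathcomp Require Import all_boot all_order all_algebra.
From mathcomp Require Import finmap mpoly zify ring.
From Stdlib Require Import Classical ClassicalEpsilon.

Set Implicit Arguments.
Unset Strict Implicit.
Unset Printing Implicit Defensive.

Import GRing.Theory Num.Theory.
Local Open Scope ring_scope.

(** Write [S] for the Cox ring, [I] for the ideal of the points and [F] for the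
    minimal free resolution of [S/I].

    A generator of [F_p] of bidegree [r] is detected by the Koszul homology
    [H_p(x_0, x_1, y_0, y_1; S/I)_r], which is [Tor_p(S/I, k)_r]: dimension
    shifting along the resolution ([koszul_acyclic_shift]) shows that there is no
    such generator if this homology vanishes ([koszul_acyclic_no_generator]). So
    [F_p = 0] for [p > 4], there being four variables, and [F_4 = 0] because
    [S/I] has no socle. What has to be shown is that in the bidegrees
    [r <= (i+1, i'+1)] there are no generators of [F_3] and there is one of [F_2].

    A Koszul 3-cycle of bidegree [r] modulo [I] contains a form [q] of [I] of
    bidegree [r - (2, 0)], and is a boundary when [q = 0] ([koszul_acyclic3]). As
    the Hilbert function is generic, [I] has no nonzero form of bidegree [(s, s')]
    if [(s+1)(s'+1) <= n]. In case (a) this always gives [q = 0]. In case (b) it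
    does so except for [r = (i+1, i'+1)], where [q] has bidegree [(i-1, i'+1)] and
    [x_0 q = y_0 g_0 + y_1 g_1] with [g_0], [g_1] in [I] of bidegree [(i, i')].
    Multiplication by the variables maps two copies of [I_(i-1,i'+1)] and two of
    [I_(i,i')] to [I_(i,i'+1)], with cokernel generated by the minimal
    generators of [I] of bidegree [(i, i'+1)]. The dimension of the source minus
    that of the target is the second difference [d = 3ii' + 4i + i' - 3n] of the
    Hilbert function in this bidegree. Now [d <= 0] by assumption, and then the
    number of generators is at most [- d], so the map is injective
    ([no_linear_syzygy]) and [q = 0].

    For [F_2], regularity gives for a point [P] a form [p] of bidegree [(i, i')]
    that vanishes at the other points but not at [P]
    ([regular_separating_form]); in particular [i] and [i'] are not negative. If
    [l] and [m] are the linear forms in the [x] and in the [y] that vanish at [P],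
    then [m p] and [l p] lie in [I], and [l (m p) = m (l p)] is a relation that
    cannot come from a trivial one, since [p] is not in [I]. Hence [F_2] has a
    generator in the range ([second_syzygy_generator]). *)

(** * Division by a variable *)

Section VariableQuotient.
Variables (R : comNzRingType) (n : nat).
Implicit Types (f g : {mpoly R[n]}) (m : 'X_{1..n}) (c : 'I_n).

Definition xdiv c f : {mpoly R[n]} :=
  \sum_(m <- msupp f | (0 < m c)%N) f@_m *: 'X_[(m - U_(c))%MM].

Lemma xdivE c f m : (xdiv c f)@_m = f@_(m + U_(c))%MM.
Proof.
rewrite /xdiv raddf_sum /=.
under eq_bigr do rewrite mcoeffZ mcoeffX.
have Uc : (0 < (m + U_(c))%MM c)%N by rewrite mnmDE mnm1E eqxx addn1.
have [mf|mf] := boolP ((m + U_(c))%MM \in msupp f); last first.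
  rewrite (memN_msupp_eq0 mf) big_seq_cond big1 // => m' /andP[m'f cm'].
  have [e|_] := eqVneq (m' - U_(c))%MM m; last by rewrite mulr0.
  by rewrite -e submK ?m'f ?lep1mP -?lt0n // in mf.
rewrite big_mkcond (bigD1_seq (m + U_(c))%MM) ?msupp_uniq //= Uc.
rewrite addmK eqxx mulr1 big1 ?addr0 // => m' ne; case: ifP => // cm'.
have [e|_] := eqVneq (m' - U_(c))%MM m; last by rewrite mulr0.
by rewrite -e submK ?eqxx // ?lep1mP -?lt0n in ne.
Qed.

Lemma xdiv_is_zmod_morphism c : zmod_morphism (xdiv c).
Proof. by move=> f g; apply/mpolyP => m; rewrite mcoeffB !xdivE mcoeffB. Qed.

HB.instance Definition _ c :=
  GRing.isZmodMorphism.Build _ _ (xdiv c) (xdiv_is_zmod_morphism c).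

Lemma mcoeffXl b f m :
  ('X_b * f)@_m = if (0 < m b)%N then f@_(m - U_(b))%MM else 0.
Proof.
rewrite mulrC; have [bm|bm] := boolP (0 < m b)%N.
  have le : (U_(b) <= m)%MM by rewrite lep1mP -lt0n.
  by rewrite -[in LHS](submK le) addmC mcoeffMX.
apply: memN_msupp_eq0; rewrite (perm_mem (msuppMX _ _)).
apply/mapP => -[m' _ e]; move: bm; rewrite e mnmDE mnm1E eqxx.
by rewrite ?addn1 ?add1n.
Qed.

Lemma xdivX c f : xdiv c ('X_c * f) = f.
Proof.
by apply/mpolyP => m; rewrite xdivE mcoeffXl mnmDE mnm1E eqxx addn1 addmK.
Qed.

Lemma xdivXne c b f : b != c -> xdiv c ('X_b * f) = 'X_b * xdiv c f.
Proof.
move=> ne; apply/mpolyP => m; rewrite xdivE !mcoeffXl mnmDE mnm1E.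
rewrite eq_sym (negPf ne) addn0; case: ifP => // bm.
rewrite xdivE; congr (f@_ _); apply/mnmP => a.
rewrite !(mnmBE, mnmDE, mnm1E); case: (b =P a) bm => [<- | _] bm.
  by rewrite eq_sym (negPf ne) !addn0.
by rewrite !subn0.
Qed.

Lemma mcoeff_xrem c f m :
  (f - 'X_c * xdiv c f)@_m = if m c == 0%N then f@_m else 0.
Proof.
rewrite mcoeffB mcoeffXl lt0n; case: eqP => cm; rewrite ?subr0 //=.
by rewrite xdivE submK ?subrr // lep1mP; apply/eqP.
Qed.

End VariableQuotient.

(** * Bihomogeneous forms *)

Definition vdeg (c : 'I_4) : int * int := bideg U_(c)%MM.

Lemma vdegE (c : 'I_4) : vdeg c = if (c < 2)%N then (1, 0) else (0, 1).
Proof. by rewrite /vdeg /bideg !mnm1E; case: c => -[|[|[|[|//]]]] ?. Qed.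

Section Bigraded.
Variable k : fieldType.
Implicit Types (f g : cox k) (r s : int * int) (c : 'I_4).

Lemma bihomogN r f : bihomog r f -> bihomog r (- f).
Proof. by move=> hf; rewrite -sub0r; apply: bihomogB => //; exact: bihomog0. Qed.

Lemma bihomogD r f g : bihomog r f -> bihomog r g -> bihomog r (f + g).
Proof.
by move=> hf hg; rewrite -[g]opprK; apply: bihomogB => //; exact: bihomogN.
Qed.

Lemma bihomog_sum (I : Type) (l : seq I) (P : pred I) r (f : I -> cox k) :
  (forall a, P a -> bihomog r (f a)) -> bihomog r (\sum_(a <- l | P a) f a).
Proof.
by move=> h; elim/big_ind: _ => //; [exact: bihomog0 | exact: bihomogD].
Qed.

Lemma bihomogX c : bihomog (vdeg c) ('X_c : cox k).
Proof. by move=> m; rewrite msuppX inE => /eqP ->. Qed.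

Lemma bihomogC (a : k) : bihomog 0 (a%:MP : cox k).
Proof.
move=> m; rewrite msuppC; case: eqP => // _.
by rewrite inE => /eqP ->; rewrite /bideg !mnmE.
Qed.

Lemma bihomog_expn r f m : bihomog r f -> bihomog (r *+ m) (f ^+ m).
Proof.
move=> hf; elim: m => [|m IH].
  by rewrite expr0 mulr0n -mpolyC1; exact: bihomogC.
by rewrite exprS mulrS; exact: bihomogM.
Qed.

Lemma bihomogZ r (a : k) f : bihomog r f -> bihomog r (a *: f).
Proof.
by move=> hf; rewrite -mul_mpolyC -[r]add0r; apply: bihomogM => //; exact: bihomogC.
Qed.

Lemma bihomogXM c r f : bihomog (r - vdeg c) f -> bihomog r ('X_c * f).
Proof.
by move=> hf; rewrite -[r](subrK (vdeg c)) addrC; apply: bihomogM => //; exact: bihomogX.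
Qed.

Lemma bihomog_xdiv c r f : bihomog r f -> bihomog (r - vdeg c) (xdiv c f).
Proof.
move=> hf m; rewrite mcoeff_msupp xdivE -mcoeff_msupp => /hf <-.
by rewrite bidegD addrK.
Qed.

Lemma bihomog_neg r f : (r.1 < 0) || (r.2 < 0) -> bihomog r f -> f = 0.
Proof.
move=> neg hf; apply: msuppnil0; case e: (msupp f) => [//|m s].
have /hf re : m \in msupp f by rewrite e mem_head.
by move: neg; rewrite -re.
Qed.

Lemma bihomog_const r f : bihomog r f -> f@_0%MM != 0 -> r = 0.
Proof.
by move=> hf; rewrite -mcoeff_msupp => /hf <-; rewrite /bideg !mnmE.
Qed.

Lemma bihomog0C f : bihomog 0 f -> f = (f@_0%MM)%:MP.
Proof.
move=> hf; apply/mpolyP => m; rewrite mcoeffC.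
have [->|m0] := eqVneq m 0%MM; first by rewrite mulr1.
rewrite mulr0; apply/memN_msupp_eq0; apply: contraNN m0 => /hf [].
move=> e1 e2; apply/eqP/mnmP => a; rewrite mnmE.
case: a => -[|[|[|[|//]]]] ha; move: e1 e2.
- rewrite (_ : Ordinal ha = 0%R); last exact: val_inj.
  by move=> e1 e2; lia.
- by rewrite (_ : Ordinal ha = 1%R); [lia | exact: val_inj].
- by rewrite (_ : Ordinal ha = 2%:R); [lia | exact: val_inj].
- by rewrite (_ : Ordinal ha = 3%:R); [lia | exact: val_inj].
Qed.

Lemma bipartMr r s f g : bihomog s g ->
  bipart r (f * g) = bipart (r - s) f * g.
Proof.
move=> hg; rewrite {1}[f]bipart_sum mulr_suml raddf_sum /=.
have [rs|rs] := boolP (r - s \in undup [seq bideg m | m <- msupp f]).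
  rewrite (bigD1_seq (r - s)) ?undup_uniq //= big1 ?addr0.
    apply: bipart_id; have {1}-> : r = (r - s) + s by rewrite subrK.
    by apply: bihomogM => //; exact: bipart_homog.
  move=> t ne; apply: (@bipart_ne _ (t + s)); last by rewrite -subr_eq eq_sym.
  by apply: bihomogM => //; exact: bipart_homog.
have -> : bipart (r - s) f = 0.
  apply/mpolyP => m; rewrite bipartE mcoeff0; case: eqP => // e.
  apply/memN_msupp_eq0; apply: contraNN rs => mg.
  by rewrite mem_undup -e map_f.
rewrite mul0r big1_seq // => t /andP[_ tg].
apply: (@bipart_ne _ (t + s)).
  by apply: bihomogM => //; exact: bipart_homog.
by rewrite -subr_eq; apply: contraNN rs => /eqP ->.
Qed.

End Bigraded.

Definition coxvars : seq 'I_4 := [:: 0; 1; 2%:R; 3%:R].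
Lemma coxvars_uniq : uniq coxvars. Proof. by []. Qed.
Lemma mem_coxvars c : c \in coxvars.
Proof. by case: c => -[|[|[|[|//]]]] ?. Qed.

(** Induction over the bidegree [s] part of the maximal ideal: dividing by the
    variables one after the other exhausts a form without constant term. *)
Lemma bihomog_maximal_ind (k : fieldType) s (P : cox k -> Prop) :
  P 0 -> (forall f g, P f -> P g -> P (f + g)) ->
  (forall c h, bihomog (s - vdeg c) h -> P ('X_c * h)) ->
  forall f, bihomog s f -> f@_0%MM = 0 -> P f.
Proof.
move=> P0 PD PX.
have ind (zs : seq 'I_4) (f : cox k) : bihomog s f ->
    (forall m : 'X_{1..4}, all (fun c => m c == 0%N) zs -> f@_m = 0) -> P f.
  elim: zs f => [|c zs IH] f hf f0.
    by rewrite (_ : f = 0) //; apply/mpolyP => m; rewrite f0 ?mcoeff0.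
  rewrite -[f](subrK ('X_c * xdiv c f)); apply: PD.
    apply: IH => [|m mz]; last by rewrite mcoeff_xrem; case: eqP => // /eqP mc; rewrite f0 //= mc.
    apply: bihomogB => //; apply: bihomogXM; exact: bihomog_xdiv.
  by apply: PX; exact: bihomog_xdiv.
move=> f hf f0; apply: (ind coxvars) => // m /allP m0.
suff -> : m = 0%MM by [].
by apply/mnmP => c; rewrite mnmE; apply/eqP/m0/mem_coxvars.
Qed.

(** * The Koszul complex *)

(** Koszul chains with coefficients in a free module of rank [m] are matrices
    with [m] columns and one row for each subset of the list of variables. For
    [c :: zs] the upper block holds the subsets without [c], the lower block
    those with [c]; the differential, acting by left multiplication, is then
    the mapping cone of [X_c]. Maps of free modules act on the right, hence
    commute with it by associativity. *)
Fixpoint kdim (zs : seq 'I_4) : nat :=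
  if zs is _ :: zs' then (kdim zs' + kdim zs')%N else 1%N.

Section Koszul.
Variable k : fieldType.
Implicit Types (zs : seq 'I_4) (r : int * int) (c : 'I_4).

Fixpoint koszul zs : 'M[cox k]_(kdim zs) :=
  if zs is c :: zs' then block_mx (koszul zs') ('X_c)%:M 0 (- koszul zs') else 0.

Lemma koszul_cons c zs m (a b : 'M_(kdim zs, m)) :
  koszul (c :: zs) *m col_mx a b =
  col_mx (koszul zs *m a + 'X_c *: b) (- (koszul zs *m b)).
Proof.
by rewrite /= mul_block_col mul_scalar_mx mul0mx add0r mulNmx.
Qed.

Lemma koszul_sq zs : koszul zs *m koszul zs = 0.
Proof.
elim: zs => [|c zs IH] /=; first by rewrite mulmx0.
rewrite mulmx_block !mul0mx !mulmx0 mul_mx_scalar mul_scalar_mx scalerN addrN.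
by rewrite mulNmx mulmxN !IH !oppr0 !addr0 block_mx0.
Qed.

(** Chains supported on the subsets of size [j] and bihomogeneous of bidegree
    [r], when the basis vector of column [b] has bidegree [t b]. *)
Fixpoint khomog zs (j : nat) r m (t : 'I_m -> int * int) :
    'M[cox k]_(kdim zs, m) -> Prop :=
  match zs with
  | c :: zs' => fun u => khomog j r t (usubmx u : 'M_(kdim zs', m)) /\
      (if j is j'.+1 then khomog j' (r - vdeg c) t (dsubmx u : 'M_(kdim zs', m))
       else dsubmx u = 0 :> 'M_(kdim zs', m))
  | [::] => fun u => if j is 0%N then forall b, bihomog (r - t b) (u 0 b)
                     else u = 0
  end.

Lemma khomog_cons c zs j r m (t : 'I_m -> int * int) (a b : 'M_(kdim zs, m)) :
  khomog (zs := c :: zs) j r t (col_mx a b) <->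
  khomog j r t a /\ (if j is j'.+1 then khomog j' (r - vdeg c) t b else b = 0).
Proof. by rewrite /= col_mxKu col_mxKd. Qed.

Lemma kcons c zs m (u : 'M[cox k]_(kdim (c :: zs), m)) :
  exists a b : 'M_(kdim zs, m), u = col_mx a b.
Proof. by exists (usubmx u), (dsubmx u); rewrite vsubmxK. Qed.

Lemma khomogB zs j r m (t : 'I_m -> int * int) (u v : 'M_(kdim zs, m)) :
  khomog j r t u -> khomog j r t v -> khomog j r t (u - v).
Proof.
elim: zs j r u v => [|c zs IH] [|j] r u v /=.
- by move=> hu hv b; rewrite !mxE; exact: bihomogB.
- by move=> -> ->; rewrite subr0.
- by move=> [hu eu] [hv ev]; rewrite !linearB /= eu ev subr0; split=> //; exact: IH.
- by move=> [hu eu] [hv ev]; rewrite !linearB /=; split; exact: IH.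
Qed.

Lemma khomogX c zs j r m (t : 'I_m -> int * int) (u : 'M_(kdim zs, m)) :
  khomog j (r - vdeg c) t u -> khomog j r t ('X_c *: u).
Proof.
elim: zs j r u => [|d zs IH] [|j] r u /=.
- move=> hu b; rewrite mxE; apply: bihomogXM.
  by rewrite addrAC; exact: hu.
- by move=> ->; rewrite scaler0.
- by move=> [hu eu]; rewrite !linearZ /= eu scaler0; split=> //; exact: IH.
- move=> [hu hv]; rewrite !linearZ /=; split; first exact: IH.
  by apply: IH; rewrite addrAC.
Qed.

Lemma khomog_xdiv c zs j r m (t : 'I_m -> int * int) (u : 'M_(kdim zs, m)) :
  khomog j r t u -> khomog j (r - vdeg c) t (map_mx (xdiv c) u).
Proof.
elim: zs j r u => [|d zs IH] [|j] r u /=.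
- by move=> hu b; rewrite mxE addrAC; apply: bihomog_xdiv; exact: hu.
- by move=> ->; rewrite map_mx0.
- by move=> [hu eu]; rewrite -map_usubmx -map_dsubmx eu map_mx0; split=> //; exact: IH.
- move=> [hu hv]; rewrite -map_usubmx -map_dsubmx; split; first exact: IH.
  by rewrite addrAC; exact: IH.
Qed.

Lemma khomogM zs j r m p (t : 'I_m -> int * int) (t' : 'I_p -> int * int)
    (u : 'M_(kdim zs, m)) (D : 'M[cox k]_(m, p)) :
  (forall a b, bihomog (t a - t' b) (D a b)) ->
  khomog j r t u -> khomog j r t' (u *m D).
Proof.
move=> hD; elim: zs j r u => [|d zs IH] [|j] r u /=.
- move=> hu b; rewrite mxE; apply: bihomog_sum => a _.
  have -> : r - t' b = (r - t a) + (t a - t' b) by rewrite addrA subrK.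
  exact: bihomogM.
- by move=> ->; rewrite mul0mx.
- by move=> [hu eu]; rewrite -mul_usub_mx -mul_dsub_mx eu mul0mx; split=> //; exact: IH.
- by move=> [hu hv]; rewrite -mul_usub_mx -mul_dsub_mx; split; exact: IH.
Qed.

Lemma khomog_gt_size zs j r m (t : 'I_m -> int * int) (u : 'M_(kdim zs, m)) :
  (size zs < j)%N -> khomog j r t u -> u = 0.
Proof.
elim: zs j r u => [|d zs IH] [|j] r u //= lt [hu hv].
rewrite -[u]vsubmxK (IH _ _ _ _ hu) 1?(IH _ _ _ _ hv) ?col_mx0 //.
exact: ltnW.
Qed.

Lemma koszul_xdiv c zs m (u : 'M_(kdim zs, m)) : c \notin zs ->
  map_mx (xdiv c) (koszul zs *m u) = koszul zs *m map_mx (xdiv c) u.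
Proof.
elim: zs u => [|d zs IH] u; first by rewrite !mul0mx map_mx0.
have [a [b ->]] := kcons u; rewrite inE negb_or => /andP[cd cz].
rewrite map_col_mx !koszul_cons map_col_mx map_mxD map_mxN !IH //.
congr (col_mx (_ + _) _); apply/matrixP => x y.
by rewrite !mxE /= xdivXne // eq_sym.
Qed.

(** The projection to, and the inclusion [kin] of, the summand of homological
    degree 0, whose row is the one of the empty subset. *)
Fixpoint ktop zs m : 'M[cox k]_(kdim zs, m) -> 'rV[cox k]_m :=
  if zs is c :: zs' then fun u => ktop (usubmx u : 'M_(kdim zs', m)) else id.

Fixpoint kin zs m (f : 'rV[cox k]_m) : 'M[cox k]_(kdim zs, m) :=
  if zs is c :: zs' then col_mx (kin zs' f) 0 else f.

Fixpoint xrems zs m (f : 'rV[cox k]_m) : 'rV[cox k]_m :=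
  if zs is c :: zs' then xrems zs' (f - 'X_c *: map_mx (xdiv c) f) else f.

Lemma koszul_kin zs m (f : 'rV_m) : koszul zs *m kin zs f = 0.
Proof.
elim: zs => [|c zs IH]; first by rewrite mul0mx.
by rewrite koszul_cons IH scaler0 addr0 mulmx0 oppr0 col_mx0.
Qed.

Lemma khomog_kin zs r m (t : 'I_m -> int * int) (f : 'rV_m) :
  (forall b, bihomog (r - t b) (f 0 b)) -> khomog 0 r t (kin zs f).
Proof. by move=> hf; elim: zs => //= c zs IH; rewrite col_mxKu col_mxKd. Qed.

Lemma ktop_kin zs m (f : 'rV_m) : ktop (kin zs f) = f.
Proof. by elim: zs => //= c zs IH; rewrite col_mxKu. Qed.

Lemma kin0 zs m : kin zs (0 : 'rV_m) = 0.
Proof. by elim: zs => //= c zs ->; rewrite col_mx0. Qed.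

Lemma ktopD zs m (u v : 'M_(kdim zs, m)) : ktop (u + v) = ktop u + ktop v.
Proof. by elim: zs u v => //= c zs IH u v; rewrite linearD IH. Qed.

Lemma ktopM zs m p (u : 'M_(kdim zs, m)) (D : 'M_(m, p)) :
  ktop (u *m D) = ktop u *m D.
Proof. by elim: zs u => //= c zs IH u; rewrite -mul_usub_mx IH. Qed.

Lemma ktopZ zs m (p : cox k) (u : 'M_(kdim zs, m)) : ktop (p *: u) = p *: ktop u.
Proof. by elim: zs u => //= c zs IH u; rewrite linearZ IH. Qed.

Lemma ktop_map zs m (g : cox k -> cox k) (u : 'M_(kdim zs, m)) :
  ktop (map_mx g u) = map_mx g (ktop u).
Proof. by elim: zs u => //= c zs IH u; rewrite -map_usubmx IH. Qed.

Lemma ktop_koszul0 zs m (u : 'M_(kdim zs, m)) b :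
  (ktop (koszul zs *m u) 0 b)@_0%MM = 0.
Proof.
elim: zs u => [|c zs IH] u; first by rewrite mul0mx mxE mcoeff0.
have [x [y ->]] := kcons u; rewrite koszul_cons /= col_mxKu ktopD mxE mcoeffD.
rewrite IH add0r ktopZ.
by rewrite mxE mcoeffXl mnmE.
Qed.

Lemma mcoeff_xrems zs m (f : 'rV_m) b e :
  (xrems zs f 0 b)@_e = if all (fun c => e c == 0%N) zs then (f 0 b)@_e else 0.
Proof.
elim: zs f => //= c zs IH f; rewrite IH !mxE mcoeff_xrem.
by case: eqP => //= _; rewrite if_same.
Qed.

(** The homology of the complex is the part free of all its variables, sitting
    in homological degree 0. One argues one variable [X_c] at a time: a cycle is
    a pair [(a, b)], [b] being the coefficient of the new basis vector.
    Subtracting the boundary of the quotient of [a] by [X_c] leaves a pair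
    [(a', b')] with [a'] free of [X_c]; the cycle condition then says that
    [X_c b'] is free of [X_c], so [b' = 0] and [a'] is a cycle for the remaining
    variables. *)
Lemma koszul_exact zs j r m (t : 'I_m -> int * int) (u : 'M_(kdim zs, m)) :
  uniq zs -> khomog j r t u -> koszul zs *m u = 0 ->
  exists2 w, khomog j.+1 r t w & u = koszul zs *m w + kin zs (xrems zs (ktop u)).
Proof.
elim: zs j r u => [|c zs IH] j r u.
  by move=> _ _ _; exists 0; rewrite ?mul0mx ?add0r.
have [a [b ->]] := kcons u.
case/andP=> cz uz /khomog_cons[ha hb].
rewrite koszul_cons => /(congr1 (fun M => (usubmx M, dsubmx M))).
rewrite col_mxKu col_mxKd !linear0 => -[e1 /eqP]; rewrite oppr_eq0 => /eqP e2.
pose q := map_mx (xdiv c) a; pose a' := a - 'X_c *: q.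
pose b' := b + koszul zs *m q.
have cyc : koszul zs *m a' + 'X_c *: b' = 0.
  by rewrite mulmxBr -scalemxAr scalerDr addrA addrAC subrK.
have qa' : map_mx (xdiv c) a' = 0.
  by apply/matrixP => x y; rewrite !mxE raddfB /= xdivX subrr.
have b'0 : b' = 0.
  have := congr1 (map_mx (xdiv c)) cyc.
  rewrite map_mxD koszul_xdiv // qa' mulmx0 add0r map_mx0 => e.
  by rewrite -[RHS]e; apply/matrixP => x y; rewrite !mxE /= xdivX.
have [|||w hw ew] := IH j r a' => //.
- by apply: khomogB => //; apply: khomogX; exact: khomog_xdiv.
- by move: cyc; rewrite b'0 scaler0 addr0.
exists (col_mx w q).
  by apply/khomog_cons; split=> //; exact: khomog_xdiv.
rewrite koszul_cons /= add_col_mx col_mxKu; congr col_mx.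
  have <- : ktop a' = ktop a - 'X_c *: map_mx (xdiv c) (ktop a).
    by rewrite /a' /q -scaleN1r ktopD !ktopZ ktop_map scaleN1r.
  by rewrite addrAC -ew subrK.
by apply/eqP; rewrite addr0 -addr_eq0 -/b' b'0.
Qed.

(** The condition on constant terms is automatic for [j > 0]; for [j = 0] it
    is what makes a vector a combination of the variables. *)
Lemma koszul_exact0 zs j r m (t : 'I_m -> int * int) (u : 'M_(kdim zs, m)) :
  uniq zs -> (forall c, c \in zs) -> khomog j r t u -> koszul zs *m u = 0 ->
  (forall b, (ktop u 0 b)@_0%MM = 0) ->
  exists2 w, khomog j.+1 r t w & u = koszul zs *m w.
Proof.
move=> uz fz hu cyc u0; have [w hw ew] := koszul_exact uz hu cyc.
exists w => //; rewrite {1}ew; suff -> : xrems zs (ktop u) = 0 by rewrite kin0 addr0.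
apply/rowP => b; apply/mpolyP => e; rewrite mcoeff_xrems mxE mcoeff0.
case: allP => // e0; suff -> : e = 0%MM by exact: u0.
by apply/mnmP => c; rewrite mnmE; apply/eqP/e0/fz.
Qed.

End Koszul.

(** * Koszul homology along a minimal resolution *)

Section KoszulHomologyOfResolution.
Variables (k : fieldType) (F : free_complex k).

Let K : 'M[cox k]_(kdim coxvars) := koszul k coxvars.

(** Vanishing in bidegree [r] of the [j]-th Koszul homology of the cokernel
    [C_p] of [fc_diff F p], in terms of representatives in [F_p]. *)
Definition koszul_acyclic p j r : Prop :=
  forall u : 'M_(kdim coxvars, fc_rank F p),
    khomog j r (@fc_shift _ F p) u ->
    (exists z, K *m u = z *m fc_diff F p) ->
    exists w z, u = K *m w + z *m fc_diff F p.

Hypothesis exact : forall p (v : 'rV_(fc_rank F p.+1)),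
  v *m fc_diff F p = 0 -> exists w, v = w *m fc_diff F p.+1.
Hypothesis minimal : forall p a b, (fc_diff F p a b)@_0%MM = 0.

Lemma mx_exact p m (v : 'M_(m, fc_rank F p.+1)) :
  v *m fc_diff F p = 0 -> exists w, v = w *m fc_diff F p.+1.
Proof.
move=> v0; have /fin_all_exists[w hw] : forall a : 'I_m,
    exists w, row a v = w *m fc_diff F p.+1.
  by move=> a; apply: exact; rewrite -row_mul v0 row0.
by exists (\matrix_a w a); apply/row_matrixP => a; rewrite row_mul rowK.
Qed.

Lemma mcoeff0_mul_diff p m (z : 'M_(m, fc_rank F p.+1)) a b :
  ((z *m fc_diff F p) a b)@_0%MM = 0.
Proof.
rewrite mxE raddf_sum big1 //= => c _.
by rewrite (rmorphM (mcoeff 0%MM)) /= minimal mulr0.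
Qed.

(** Dimension shifting along [0 -> C_p.+1 -> F_p -> C_p -> 0], where [F_p] has no
    Koszul homology in positive degree. For [j = 0] the connecting map is still
    injective because the resolution is minimal. *)
Lemma koszul_acyclic_shift p j r :
  koszul_acyclic p j.+1 r -> koszul_acyclic p.+1 j r.
Proof.
move=> acyc u hu [z ez].
have cyc : K *m (u *m fc_diff F p) = 0.
  by rewrite mulmxA ez -mulmxA fc_dd mulmx0.
have [b|y hy ey] := koszul_exact0 coxvars_uniq mem_coxvars
  (khomogM (@fc_homog _ F p) hu) cyc.
  by rewrite ktopM mcoeff0_mul_diff.
have [|w [z' ey']] := acyc y hy; first by exists u; rewrite -ey.
have [|z'' e''] := @mx_exact p _ (u - K *m z').
  apply/eqP; rewrite mulmxBl subr_eq0 ey; apply/eqP.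
  rewrite ey' mulmxDr mulmxA.
  have -> : K *m K = 0.
    exact: koszul_sq.
  by rewrite mul0mx add0r mulmxA.
by exists z', z''; rewrite -e'' addrC subrK.
Qed.

Lemma koszul_acyclic_iter p j r :
  koszul_acyclic 0 (j + p) r -> koszul_acyclic p j r.
Proof.
elim: p j => [|p IH] j; first by rewrite addn0.
by rewrite addnS -addSn => /IH; exact: koszul_acyclic_shift.
Qed.

(** Shifting [p] times leads to [j = 0], that is to [C_p] modulo the maximal
    ideal, where by minimality the generators of [F_p] stay independent. *)
Lemma koszul_acyclic_no_generator p r (a : 'I_(fc_rank F p)) :
  koszul_acyclic 0 p r -> fc_shift a != r.
Proof.
move=> acyc; apply/eqP => ar.
have {}acyc : koszul_acyclic p 0 r by apply: koszul_acyclic_iter; rewrite add0n.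
pose e : 'rV[cox k]_(fc_rank F p) := delta_mx 0 a.
have [||w [z ew]] := acyc (kin coxvars e).
- apply: khomog_kin => b; rewrite mxE eqxx /=.
  have [->|_] := eqVneq b a; last exact: bihomog0.
  by rewrite ar subrr -mpolyC1; exact: bihomogC.
- by exists 0; rewrite mul0mx /K koszul_kin.
have := congr1 (fun u => (ktop u 0 a)@_0%MM) ew.
rewrite ktop_kin ktopD mxE !eqxx mxE mcoeffD ktop_koszul0 ktopM.
by rewrite mcoeff0_mul_diff mcoeff1 eqxx addr0 => /eqP; rewrite oner_eq0.
Qed.

End KoszulHomologyOfResolution.

(** * Minimal resolutions of a quotient of the Cox ring *)

Section AugmentationOfQuotient.
Variables (k : fieldType) (I : bihideal k) (F : free_complex k).

Lemma bih0 : bih_mem I 0. Proof. by case: (bih_zmod I). Qed.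

Lemma bihB f g : bih_mem I f -> bih_mem I g -> bih_mem I (f - g).
Proof. by case: (bih_zmod I) => _; apply. Qed.

Lemma bihD f g : bih_mem I f -> bih_mem I g -> bih_mem I (f + g).
Proof.
by move=> hf hg; rewrite -[g]opprK; apply: bihB => //; rewrite -sub0r bihB ?bih0.
Qed.

Lemma bihN f : bih_mem I (- f) = bih_mem I f.
Proof. by apply/idP/idP => h; have := bihB bih0 h; rewrite sub0r ?opprK. Qed.

Lemma bih_sum (T : Type) (l : seq T) (P : pred T) (f : T -> cox k) :
  (forall a, P a -> bih_mem I (f a)) -> bih_mem I (\sum_(a <- l | P a) f a).
Proof. by move=> h; elim/big_ind: _ => //; [exact: bih0 | exact: bihD]. Qed.

Lemma qclassZ f g : f *: (qclass I g : quotmod I) = qclass I (f * g).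
Proof. exact: qscaleE. Qed.

Hypotheses (res : minimal_free_resolution (quotient_module I) F)
  (proper : ~~ bih_mem I 1).

(** A minimal resolution of [S/I] starts with a single summand [S]: the
    generators of [F_0] and the class of [1] are multiples of each other, and
    minimality makes the product of the two transition matrices the identity
    modulo the maximal ideal. *)
Lemma resolution_quotient0 : exists a0 : 'I_(fc_rank F 0),
  [/\ forall a, a = a0, fc_shift a0 = 0
    & forall m (v : 'M_(m, fc_rank F 0)),
        (exists w, v = w *m fc_diff F 0) <-> (forall x, bih_mem I (v x a0))].
Proof.
case: res => [[e [he hgen hker]] [_ hmin]].
have /fin_all_exists[g hg] : forall a, exists f,
  bihomog (fc_shift a) f /\ e a = qclass I f by move=> a; case: (he a) => f; exists f.
have [v hv] := hgen (qclass I 1).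
have qE f : qclass I f = f *: qclass I 1.
  by rewrite (qclassZ f 1) mulr1.
have prod1 a b : (g b)@_0%MM * (v 0 a)@_0%MM = (a == b)%:R.
  pose d : 'rV[cox k]_(fc_rank F 0) := \row_a ((a == b)%:R - g b * v 0 a).
  have /hker[w ew] : \sum_a d 0 a *: e a = 0.
    under eq_bigr do rewrite mxE scalerBl -scalerA.
    rewrite sumrB -scaler_sumr -hv -qE (bigD1 b) //= eqxx scale1r.
    rewrite big1 => [|c /negPf ->]; last by rewrite scale0r.
    by rewrite addr0; case: (hg b) => _ ->; rewrite subrr.
  have := congr1 (fun u : 'rV_ _ => (u 0 a)@_0%MM) ew.
  rewrite !mxE mcoeffB (rmorphM (mcoeff 0%MM)) raddf_sum /=.
  rewrite [RHS]big1 => [|c _]; last by rewrite (rmorphM (mcoeff 0%MM)) /= hmin mulr0.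
  move/eqP; rewrite subr_eq0 => /eqP <-.
  by case: eqP; rewrite ?mcoeff1 ?mcoeff0 ?eqxx.
have [a0 _|none] := pickP 'I_(fc_rank F 0); last first.
  case/negP: proper; rewrite -qclass_eq0 hv big1 // => a.
  by have := none a.
have nz a : (g a)@_0%MM != 0 /\ (v 0 a)@_0%MM != 0.
  by apply/andP; rewrite -negb_or -mulf_eq0 prod1 eqxx oner_eq0.
have uniq_a a : a = a0.
  apply/eqP; case: (nz a) (nz a0) => [_ va] [ga _].
  apply: contraT => ne; have /eqP := prod1 a a0.
  by rewrite (negPf ne) mulf_eq0 (negPf va) (negPf ga).
case: (hg a0) => hom0 e0; case: (nz a0) => g0 _.
have s0 : fc_shift a0 = 0 by exact: bihomog_const hom0 g0.
exists a0; split=> // m u.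
have gE : g a0 = ((g a0)@_0%MM)%:MP by apply: bihomog0C; rewrite -s0.
have rowP (w : 'rV_(fc_rank F 0)) :
    (exists w', w = w' *m fc_diff F 0) <-> bih_mem I (w 0 a0).
  rewrite -hker (bigD1 a0) //= big1 => [|a]; last by rewrite (uniq_a a) eqxx.
  rewrite addr0 e0 qE scalerA -qE; split.
    move/eqP; rewrite qclass_eq0 => h.
    have := bih_mul (((g a0)@_0%MM)^-1)%:MP h.
    by rewrite gE mulrC -mulrA mcoeffC eqxx mulr1 -mpolyCM mulfV // mulr1.
  by move=> h; apply/eqP; rewrite qclass_eq0 mulrC; exact: bih_mul.
split=> [[w ->] x|h].
  have /rowP : exists w', row x (w *m fc_diff F 0) = w' *m fc_diff F 0.
    by exists (row x w); rewrite row_mul.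
  by rewrite mxE.
have /fin_all_exists[w hw] : forall x, exists w', row x u = w' *m fc_diff F 0.
  by move=> x; apply/rowP; rewrite mxE.
by exists (\matrix_x w x); apply/row_matrixP => x; rewrite row_mul rowK.
Qed.

(** The rest of a minimal resolution of [S/I] in terms of the forms [D c] that
    generate [I]: every relation between them comes from [F_2]. *)
Lemma ideal_generators : exists D : 'I_(fc_rank F 1) -> cox k,
  [/\ forall c, bihomog (fc_shift c) (D c),
      forall c, bih_mem I (D c),
      forall s f, bihomog s f -> bih_mem I f ->
        exists2 w : 'rV_(fc_rank F 1), forall c, bihomog (s - fc_shift c) (w 0 c) &
          f = \sum_c w 0 c * D c
    & forall w : 'rV_(fc_rank F 1), \sum_c w 0 c * D c = 0 ->
        exists w2, w = w2 *m fc_diff F 1].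
Proof.
have [a0 [uniq_a0 s0 im]] := resolution_quotient0.
pose D c : cox k := fc_diff F 0 c a0.
have diffE (w : 'rV_(fc_rank F 1)) : (w *m fc_diff F 0) 0 a0 = \sum_c w 0 c * D c.
  by rewrite mxE.
have hD c : bihomog (fc_shift c) (D c).
  by have := @fc_homog k F 0 c a0; rewrite s0 subr0.
exists D; split=> // [c|s f hf If|w].
- have : bih_mem I (row c (fc_diff F 0) 0 a0); last by rewrite mxE.
  by apply: (proj1 (im _ (row c (fc_diff F 0)))); exists (delta_mx 0 c); rewrite rowE.
- have [w ew] : exists w, const_mx f = w *m fc_diff F 0 :> 'rV_ _.
    by apply/im => y; rewrite mxE.
  exists (\row_c bipart (s - fc_shift c) (w 0 c)) => [c|].
    by rewrite mxE; exact: bipart_homog.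
  rewrite -(bipart_id hf); have -> : f = \sum_c w 0 c * D c by rewrite -diffE -ew mxE.
  rewrite (raddf_sum (bipart s)); apply: eq_bigr => c _ /=.
  by rewrite mxE (bipartMr _ _ (hD c)).
move=> w0; case: res => _ [exact _]; apply: exact.
by apply/rowP => c; rewrite (uniq_a0 c) diffE w0 mxE.
Qed.

End AugmentationOfQuotient.

(** * Koszul homology of a saturated quotient *)

Section KoszulHomologyOfQuotient.
Variables (k : fieldType) (I : bihideal k) (F : free_complex k).
Hypotheses (res : minimal_free_resolution (quotient_module I) F)
  (proper : ~~ bih_mem I 1).
Hypothesis saturated : forall f,
  bih_mem I ('X_2%:R * f) -> bih_mem I ('X_3%:R * f) -> bih_mem I f.

Let K : 'M[cox k]_(kdim coxvars) := koszul k coxvars.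

Lemma koszul_nil m (a : 'M[cox k]_(kdim [::], m)) : koszul k [::] *m a = 0.
Proof. exact: mul0mx. Qed.

Definition col_in m' m (c : 'I_m) (u : 'M[cox k]_(m', m)) : Prop :=
  forall x, bih_mem I (u x c).

Lemma col_in_col_mx m1 m2 m (a : 'M_(m1, m)) (b : 'M_(m2, m)) c :
  col_in c (col_mx a b) <-> col_in c a /\ col_in c b.
Proof.
split=> [h|[ha hb] x]; last by rewrite mxE; case: split.
by split=> x; [have := h (lshift _ x) | have := h (rshift _ x)];
  rewrite (col_mxEu, col_mxEd).
Qed.

Lemma col_in0 m' m (c : 'I_m) : col_in c (0 : 'M_(m', m)).
Proof. by move=> x; rewrite mxE bih0. Qed.

(** The general Koszul chains of homological degrees 4 and 3. In [kchain3] the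
    rows [v_a] and [u_b] belong to the subsets [{x_a, y_0, y_1}] and
    [{x_0, x_1, y_b}]. *)
Definition kchain4 m (s : 'M[cox k]_(1, m)) : 'M_(kdim coxvars, m) :=
  col_mx 0 (col_mx 0 (col_mx 0 (col_mx 0 s))).

Definition kchain3 m (v0 v1 u0 u1 : 'M[cox k]_(1, m)) : 'M_(kdim coxvars, m) :=
  col_mx
    (col_mx 0 (col_mx 0 (col_mx 0 v1)))
    (col_mx (col_mx 0 (col_mx 0 v0)) (col_mx (col_mx 0 u1) (col_mx u0 0))).

Lemma khomog4P r m (t : 'I_m -> int * int) (u : 'M_(kdim coxvars, m)) :
  khomog 4 r t u -> exists s, u = kchain4 s.
Proof.
move=> hu; have [A0 [A1 e]] := kcons u; move: hu; rewrite {u}e.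
have [B0 [B1 ->]] := kcons A1; have [C0 [C1 ->]] := kcons B1.
have [D0 [s ->]] := kcons C1.
case/khomog_cons=> hA /khomog_cons[hB /khomog_cons[hC /khomog_cons[hD _]]].
exists s; rewrite /kchain4 (khomog_gt_size _ hA) // (khomog_gt_size _ hB) //.
by rewrite (khomog_gt_size _ hC) // (khomog_gt_size _ hD).
Qed.

Lemma khomog3P r m (t : 'I_m -> int * int) (u : 'M_(kdim coxvars, m)) :
  khomog 3 r t u -> exists v0 v1 u0 u1, u = kchain3 v0 v1 u0 u1 /\
    forall b, [/\ bihomog (r - (1, 2%:Z) - t b) (v0 0 b),
      bihomog (r - (1, 2%:Z) - t b) (v1 0 b),
      bihomog (r - (2%:Z, 1) - t b) (u0 0 b)
      & bihomog (r - (2%:Z, 1) - t b) (u1 0 b)].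
Proof.
move=> hu; have [A0 [A1 e]] := kcons u; move: hu; rewrite {u}e.
have [A00 [A01 ->]] := kcons A0; have [A10 [A11 ->]] := kcons A1.
have [B0 [B1 ->]] := kcons A01; have [C0 [C1 ->]] := kcons A10.
have [D0 [D1 ->]] := kcons A11.
have [B10 [v1 ->]] := kcons B1; have [C10 [v0 ->]] := kcons C1.
have [D00 [u1 ->]] := kcons D0; have [u0 [D11 ->]] := kcons D1.
case/khomog_cons=> /khomog_cons[hA00 /khomog_cons[hB0 /khomog_cons[hB10 hv1]]].
case/khomog_cons=> /khomog_cons[hC0 /khomog_cons[hC10 hv0]].
case/khomog_cons=> /khomog_cons[hD00 hu1] /khomog_cons[hu0 hD11].
exists v0, v1, u0, u1; split.
  rewrite (khomog_gt_size _ hA00) // (khomog_gt_size _ hB0) //.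
  rewrite (khomog_gt_size _ hB10) // (khomog_gt_size _ hC0) //.
  by rewrite (khomog_gt_size _ hC10) // (khomog_gt_size _ hD00) // hD11.
move: hv1 hv0 hu1 hu0; rewrite /= !vdegE /= -!addrA -!opprD => hv1 hv0 hu1 hu0 b.
split; rewrite -addrA -opprD; [have := hv0 b|have := hv1 b|have := hu0 b|have := hu1 b];
 by rewrite -!addrA -?opprD.
Qed.

Lemma koszul_kchain4 m (s : 'M_(1, m)) :
  K *m kchain4 s = kchain3 (- ('X_1%R *: s)) ('X_0%R *: s)
     (- ('X_3%:R *: s)) ('X_2%:R *: s).
Proof.
rewrite /K /kchain4 /kchain3 /coxvars !koszul_cons !koszul_nil.
rewrite !(mulmx0, scaler0, addr0, add0r, oppr0, scale_col_mx, opp_col_mx, add_col_mx, opprK).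
by [].
Qed.

Lemma koszul_kchain3 m (v0 v1 u0 u1 : 'M_(1, m)) :
  K *m kchain3 v0 v1 u0 u1 =
  col_mx
    (col_mx (col_mx 0 (col_mx 0 ('X_1%R *: v1 + 'X_0%R *: v0)))
       (col_mx (col_mx 0 (- ('X_2%:R *: v1) + 'X_0%R *: u1))
          (col_mx ('X_3%:R *: v1 + 'X_0%R *: u0) 0)))
    (col_mx (col_mx (col_mx 0 (- ('X_2%:R *: v0 + 'X_1%R *: u1)))
               (col_mx (- (- ('X_3%:R *: v0) + 'X_1%R *: u0)) 0))
       (col_mx (col_mx ('X_3%:R *: u1 + 'X_2%:R *: u0) 0) 0)).
Proof.
rewrite /K /kchain3 /coxvars !koszul_cons !koszul_nil.
rewrite !(mulmx0, scaler0, addr0, add0r, oppr0, scale_col_mx, opp_col_mx, add_col_mx, opprK).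
by rewrite col_mx0.
Qed.

Lemma koszul_acyclic0P j r :
  (forall m (t : 'I_m -> int * int) (a0 : 'I_m) u, t a0 = 0 ->
     khomog j r t u -> col_in a0 (K *m u) ->
     exists w, col_in a0 (u - K *m w)) ->
  koszul_acyclic F 0 j r.
Proof.
move=> h u hu; have [a0 [_ t0 im]] := resolution_quotient0 res proper.
move=> /im /(h _ _ _ _ t0 hu)[w /im[z ez]].
by exists w, z; rewrite -ez addrC subrK.
Qed.

(** The homology in degree 4 is the socle of [S/I], which is zero because [I]
    is saturated. *)
Lemma koszul_acyclic4 r : koszul_acyclic F 0 4 r.
Proof.
apply: koszul_acyclic0P => m t a0 u _ /khomog4P[s ->].
rewrite koszul_kchain4 /kchain3 => hK; exists 0; rewrite mulmx0 subr0.
case/col_in_col_mx: hK => _ /col_in_col_mx[_ /col_in_col_mx[]].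
move=> /col_in_col_mx[_ h2] /col_in_col_mx[h3 _].
do 4!(apply/col_in_col_mx; split; first exact: col_in0).
move=> x; apply: saturated.
  by have := h2 x; rewrite mxE.
by have := h3 x; rewrite !mxE bihN.
Qed.

(** A 3-chain [(v0, v1, u0, u1)] whose boundary is zero in [S/I] gives the form
    [q = y_0 u_0 + y_1 u_1] of [I], and [x_0 q] lies in [(y_0, y_1) I]. When [q]
    vanishes, the pair [(u_0, u_1)] is a multiple of [(- y_1, y_0)], and subtracting a
    boundary reduces the cycle to elements that the [y_b] multiply into [I]. *)
Lemma koszul_acyclic3 r :
  (forall q g0 g1, bih_mem I q -> bih_mem I g0 -> bih_mem I g1 ->
     bihomog (r - (2%:Z, 0)) q -> bihomog (r - (1, 1)) g0 ->
     bihomog (r - (1, 1)) g1 ->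
     'X_0%R * q = 'X_2%:R * g0 + 'X_3%:R * g1 -> q = 0) ->
  koszul_acyclic F 0 3 r.
Proof.
move=> no_syzygy; apply: koszul_acyclic0P => m t a0 u t0.
case/khomog3P=> v0 [v1 [u0 [u1 [-> /(_ a0)]]]]; rewrite t0 !subr0.
case=> hv0 hv1 hu0 hu1; rewrite koszul_kchain3 => /col_in_col_mx[].
case/col_in_col_mx=> _ /col_in_col_mx[/col_in_col_mx[_ Ig1] /col_in_col_mx[Ig0 _]].
case/col_in_col_mx=> /col_in_col_mx[/col_in_col_mx[_ If1] /col_in_col_mx[If0 _]].
case/col_in_col_mx=> /col_in_col_mx[Iq _] _.
move: {Ig1}(Ig1 0) {Ig0}(Ig0 0) {If1}(If1 0) {If0}(If0 0) {Iq}(Iq 0).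
rewrite !mxE; set a := v0 0 a0; set b := v1 0 a0; set c := u0 0 a0; set d := u1 0 a0.
move=> Ig1 Ig0 If1 If0 Iq.
have q0 : 'X_3%:R * d + 'X_2%:R * c = 0.
  apply: (no_syzygy _ _ _ Iq Ig0 Ig1); last by ring.
  - by apply: bihomogD; apply: bihomogXM; rewrite vdegE -addrA -opprD.
  - by apply: bihomogD; apply: bihomogXM; rewrite vdegE -addrA -opprD.
  apply: bihomogD; last by apply: bihomogXM; rewrite vdegE -addrA -opprD.
  rewrite -mulrN; apply: bihomogXM; rewrite vdegE -addrA -opprD.
  exact: bihomogN.
(* [q = 0] makes [d] divisible by [y_0]; the quotient is the wanted 4-chain. *)
pose W := xdiv (2%:R) d.
have cE : c = - ('X_3%:R * W).
  have := congr1 (xdiv 2%:R) q0.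
  rewrite raddfD /= xdivX xdivXne // raddf0 => /eqP.
  by rewrite addrC addr_eq0 => /eqP.
have dE : d = 'X_2%:R * W.
  apply: (can_inj (@xdivX _ _ 3%:R)).
  by move/eqP: q0; rewrite addr_eq0 cE => /eqP ->; ring.
exists (kchain4 (const_mx W)); rewrite koszul_kchain4 /kchain3.
rewrite !(opp_col_mx, add_col_mx, oppr0, addr0, opprK).
do !(apply/col_in_col_mx; split); try exact: col_in0.
- move=> x; rewrite ord1 !mxE; apply: saturated; rewrite -/b.
    by rewrite -bihN; move: Ig1; congr (is_true (bih_mem I _)); rewrite dE; ring.
  by move: Ig0; congr (is_true (bih_mem I _)); rewrite cE; ring.
- move=> x; rewrite ord1 !mxE; apply: saturated; rewrite -/a.
    by rewrite -bihN; move: If1; congr (is_true (bih_mem I _)); rewrite dE; ring.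
  by move: If0; congr (is_true (bih_mem I _)); rewrite cE; ring.
- by move=> x; rewrite ord1 !mxE -/d -dE subrr bih0.
- by move=> x; rewrite ord1 !mxE -/c cE addNr bih0.
Qed.

End KoszulHomologyOfQuotient.

(** * Evaluation of forms at the points *)

Section Forms.
Variables (k : fieldType) (i i' : nat).

(** The exponents of the monomials
    [x_0^(i-a.1) x_1^(a.1) y_0^(i'-a.2) y_1^(a.2)], which form a basis of the
    piece of bidegree [(i, i')]. *)
Definition biexp (a : 'I_i.+1 * 'I_i'.+1) : 'X_{1..4} :=
  [multinom nth 0%N [:: (i - a.1)%N; val a.1; (i' - a.2)%N; val a.2] c | c < 4].

Definition nforms : nat := #|{: 'I_i.+1 * 'I_i'.+1}|.

Lemma nformsE : nforms = (i.+1 * i'.+1)%N.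
Proof. by rewrite /nforms card_prod !card_ord. Qed.

Definition form (v : 'rV[k]_nforms) : cox k :=
  \sum_a v 0 a *: 'X_[biexp (enum_val a)].

Lemma form_is_linear : linear form.
Proof.
move=> c u v; rewrite /form scaler_sumr -big_split; apply: eq_bigr => a _.
by rewrite !mxE scalerDl scalerA.
Qed.

HB.instance Definition _ :=
  GRing.isLinear.Build k 'rV[k]_nforms (cox k) *:%R form form_is_linear.

Lemma bideg_biexp a : bideg (biexp a) = (i%:Z, i'%:Z).
Proof.
rewrite /bideg !mnmE /=; congr (_%:Z, _%:Z); apply: subnK.
  by rewrite -ltnS.
by rewrite -ltnS.
Qed.

Lemma biexp_inj : injective biexp.
Proof.
move=> [a b] [c d] /mnmP e; have := e 1%R; have := e 3%:R.
by rewrite !mnmE /= => /val_inj -> /val_inj ->.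
Qed.

Lemma form_bihomog v : bihomog (i%:Z, i'%:Z) (form v).
Proof.
apply: bihomog_sum => a _; apply: bihomogZ => m.
by rewrite msuppX inE => /eqP ->; exact: bideg_biexp.
Qed.

Lemma mcoeff_form v a : (form v)@_(biexp (enum_val a)) = v 0 a.
Proof.
rewrite raddf_sum (bigD1 a) //= mcoeffZ mcoeffX eqxx mulr1 big1 ?addr0 // => b ne.
rewrite mcoeffZ mcoeffX; case: eqP => [/biexp_inj/enum_val_inj e|_].
  by rewrite e eqxx in ne.
by rewrite mulr0.
Qed.

Lemma form_surj f : bihomog (i%:Z, i'%:Z) f -> exists v, f = form v.
Proof.
move=> hf; exists (\row_a f@_(biexp (enum_val a))); apply/mpolyP => m.
have [bm|ne] := eqVneq (bideg m) (i%:Z, i'%:Z); last first.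
  rewrite (memN_msupp_eq0 (contraNN (fun h => introT eqP (hf m h)) ne)).
  by rewrite memN_msupp_eq0 //; apply: contraNN ne => /form_bihomog ->.
case: bm => em em'; have h1 : (m 1%R < i.+1)%N by lia.
have h3 : (m 3%:R < i'.+1)%N by lia.
have -> : m = biexp (enum_val (enum_rank (Ordinal h1, Ordinal h3))).
  rewrite enum_rankK; apply/mnmP => -[[|[|[|[|//]]]] hc]; rewrite mnmE /=.
  - by rewrite (_ : Ordinal hc = 0%R); [lia | exact: val_inj].
  - by congr (m _); exact: val_inj.
  - by rewrite (_ : Ordinal hc = 2%:R); [lia | exact: val_inj].
  - by congr (m _); exact: val_inj.
by rewrite mcoeff_form mxE.
Qed.

End Forms.

Section EvaluationMatrix.
Variables (k : fieldType) (n : nat) (t : n.-tuple (P1xP1 k)).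

Lemma vanishing_homogP r f : bihomog r f ->
  reflect (forall l, eval_at (tnth t l) f = 0) (vanishing (point_set t) f).
Proof.
move=> hf; apply: (iffP (vanishingP _ _)) => [h l|h s P].
  by rewrite -{1}(bipart_id hf) h // in_fset mem_tnth.
rewrite in_fset => /tnthP[l ->]; have [->|ne] := eqVneq s r.
  by rewrite bipart_id.
by rewrite (bipart_ne hf ne) /eval_at meval0.
Qed.

Variables (i i' : nat).
Let N := nforms i i'.

Definition evalmx : 'M[k]_(N, n) :=
  \matrix_(a, l) eval_at (tnth t l) 'X_[biexp (enum_val a)].

Lemma evalmxE (v : 'rV_N) l : (v *m evalmx) 0 l = eval_at (tnth t l) (form v).
Proof.
rewrite mxE /eval_at /form raddf_sum /=; apply: eq_bigr => a _.
by rewrite mxE mevalZ.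
Qed.

Lemma vanishing_form (v : 'rV_N) :
  vanishing (point_set t) (form v) = (v *m evalmx == 0).
Proof.
apply/idP/eqP => [/(vanishing_homogP (@form_bihomog k i i' v)) h|h].
  by apply/rowP => l; rewrite evalmxE h mxE.
by apply/(vanishing_homogP (@form_bihomog k i i' v)) => l; rewrite -evalmxE h mxE.
Qed.

Let I := ideal_of_points (point_set t).
Let M := coordinate_module (point_set t).

Lemma qclass_formZ d (b : 'I_d -> 'rV[k]_N) (c : 'rV[k]_d) :
  \sum_a (c 0 a)%:MP *: (qclass I (form (b a)) : M) =
  qclass I (form (c *m (\matrix_a b a))).
Proof.
rewrite mulmx_sum_row linear_sum raddf_sum; apply: eq_bigr => a _.
rewrite rowK linearZ /= -mul_mpolyC; exact: qscaleE.
Qed.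

Lemma qclass_form_eq (u v : 'rV[k]_N) :
  qclass I (form u) = qclass I (form v) <-> u *m evalmx = v *m evalmx.
Proof.
split=> [/eqP|/eqP]; rewrite -subr_eq0.
  by rewrite -raddfB -linearB /= qclass_eq0 /= vanishing_form mulmxBl subr_eq0 => /eqP.
move=> h; apply/eqP; rewrite -subr_eq0 -raddfB -linearB /= qclass_eq0 /=.
by rewrite vanishing_form mulmxBl.
Qed.

(** [S/I] in bidegree [(i, i')] is the space of forms modulo the kernel of the
    evaluation at the points, that is the row space of [evalmx]. *)
Lemma piece_has_dimP d :
  piece_has_dim M (i%:Z, i'%:Z) d <-> d = \rank evalmx.
Proof.
split=> [[b [hb hu]]|->].
  have /fin_all_exists[f hf] : forall a, exists v : 'rV[k]_N, b a = qclass I (form v).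
    by move=> a; case: (hb a) => g /form_surj[v ->] ->; exists v.
  pose B := \matrix_a f a.
  have sumE (c : 'rV[k]_d) : \sum_a (c 0 a)%:MP *: b a = qclass I (form (c *m B)).
    by under eq_bigr do rewrite hf; exact: qclass_formZ.
  have free : row_free (B *m evalmx).
    rewrite -kermx_eq0; apply/rowV0P => c /sub_kermxP; rewrite mulmxA => c0.
    have [|c' [_ uniq_c]] := hu 0; first exact: qpiece0.
    have form0 : 0 = qclass I (form (0 : 'rV[k]_N)) by rewrite linear0 raddf0.
    rewrite -(uniq_c c) ?(uniq_c 0) // sumE {1}form0.
      by rewrite mul0mx.
    by apply/qclass_form_eq; rewrite c0 mul0mx.
  rewrite -(eqP free); apply: eqmx_rank; apply/andP; split.
    exact: submxMl.
  apply/row_subP => x; rewrite rowE.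
  have [|c [ec _]] := hu (qclass I (form (delta_mx 0 x))).
    by exists (form (delta_mx 0 x)) => //; exact: form_bihomog.
  move: ec; rewrite sumE => /qclass_form_eq ->.
  by rewrite -mulmxA submxMl.
have /submxP[B eB] : (row_base evalmx <= evalmx)%MS by rewrite eq_row_base.
exists (fun a => qclass I (form (row a B))); split=> [a|u [f hf ->]].
  by exists (form (row a B)) => //; exact: form_bihomog.
have [v ->] := form_surj hf.
have BE : \matrix_a row a B = B by apply/row_matrixP => a; rewrite rowK.
have /submxP[c ec] : (v *m evalmx <= row_base evalmx)%MS.
  by rewrite eq_row_base submxMl.
exists c; split=> [|c']; rewrite qclass_formZ BE.
  by apply/qclass_form_eq; rewrite -mulmxA -eB.
move/qclass_form_eq; rewrite ec -mulmxA -eB => e.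
by apply: (row_free_inj (row_base_free evalmx)).
Qed.

Lemma hilbert_rank : hilbert (point_set t) i i' = \rank evalmx.
Proof.
apply/piece_has_dimP; apply: epsilon_spec.
by exists (\rank evalmx); apply/piece_has_dimP.
Qed.

End EvaluationMatrix.

Section Coordinates.
Variables (k : fieldType) (i i' : nat).

Definition coords (f : cox k) : 'rV[k]_(nforms i i') :=
  \row_a f@_(biexp (enum_val a)).

Lemma coords_is_linear : linear coords.
Proof. by move=> c f g; apply/rowP => a; rewrite !mxE mcoeffD mcoeffZ. Qed.

HB.instance Definition _ :=
  GRing.isLinear.Build k (cox k) 'rV[k]_(nforms i i') *:%R coords coords_is_linear.

Lemma formK : cancel (@form k i i') coords.
Proof. by move=> v; apply/rowP => a; rewrite mxE mcoeff_form. Qed.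

End Coordinates.

Section MultiplicationByVariable.
Variable k : fieldType.

Definition mulX c i i' j j' (v : 'rV[k]_(nforms i i')) : 'rV[k]_(nforms j j') :=
  coords j j' ('X_c * form v).

Lemma mulX_is_linear c i i' j j' : linear (@mulX c i i' j j').
Proof. by move=> a u v; rewrite /mulX linearP mulrDr -scalerAr linearP. Qed.

HB.instance Definition _ c i i' j j' :=
  GRing.isLinear.Build k 'rV[k]_(nforms i i') 'rV[k]_(nforms j j') *:%R
    (@mulX c i i' j j') (@mulX_is_linear c i i' j j').

End MultiplicationByVariable.

Section GenericPoints.
Variables (k : fieldType) (n : nat) (t : n.-tuple (P1xP1 k)).
Hypotheses (t_uniq : uniq t) (generic : generic_hilbert (point_set t)).

Let I := ideal_of_points (point_set t).

Lemma card_point_set : #|` point_set t|%fset = n.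
Proof.
by rewrite card_fseq undup_id ?size_tuple.
Qed.

Lemma rank_evalmx i i' : \rank (evalmx t i i') = minn n (i.+1 * i'.+1).
Proof. by rewrite -hilbert_rank generic card_point_set. Qed.

(** In a bidegree with at most [n] monomials, genericity makes the evaluation
    injective; the next lemma uses that it is surjective when there are at
    least [n]. *)
Lemma no_vanishing_form (r : int * int) f :
  (r.1 < 0) || (r.2 < 0) || ((r.1 + 1) * (r.2 + 1) <= n%:Z) ->
  bihomog r f -> vanishing (point_set t) f -> f = 0.
Proof.
case: (boolP ((r.1 < 0) || (r.2 < 0))) => [neg _|pos /= le] hf.
  by rewrite (bihomog_neg neg hf).
case: r pos le hf => [[i|i] [i'|i']] //= _ le hf.
have [v ->] := form_surj hf; rewrite vanishing_form => /eqP v0.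
have free : row_free (evalmx t i i').
  by rewrite /row_free rank_evalmx nformsE; apply/eqP/minn_idPr; lia.
suff -> : v = 0 by rewrite linear0.
by apply: (row_free_inj free); rewrite v0 mul0mx.
Qed.

Lemma separating_form i i' l : (n <= i.+1 * i'.+1)%N ->
  exists2 f, bihomog (i%:Z, i'%:Z) f &
    forall l', eval_at (tnth t l') f = (l' == l)%:R.
Proof.
move=> le; have /row_fullP[B BE] : row_full (evalmx t i i').
  by rewrite /row_full rank_evalmx; apply/eqP/minn_idPl.
exists (form (row l B)); first exact: form_bihomog.
by move=> l'; rewrite -evalmxE -row_mul BE !mxE eq_sym.
Qed.

Definition kerev i i' := row_base (kermx (evalmx t i i')).

Lemma vanishing_kerev i i' (v : 'rV_(nforms i i')) :
  vanishing (point_set t) (form v) = (v <= kerev i i')%MS.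
Proof. by rewrite vanishing_form eq_row_base; apply/eqP/sub_kermxP. Qed.

Lemma rank_kerev i i' : (n <= i.+1 * i'.+1)%N ->
  (\rank (kermx (evalmx t i i')) + n)%N = (i.+1 * i'.+1)%N.
Proof.
by move=> le; rewrite mxrank_ker rank_evalmx nformsE; lia.
Qed.

End GenericPoints.

(** * The ideal of a set of points *)

Section PointCoordinates.
Variable k : fieldType.
Implicit Types (P : P1xP1 k) (f : cox k).

Lemma vpick_P1_neq0 (L : P1 k) : vpick (val L) != 0.
Proof. by rewrite vpick0 -dimv_eq0 (eqP (valP L)). Qed.

Lemma hcoord_x P : (hcoord P 0 (0 : 'I_4) != 0) || (hcoord P 0 (1 : 'I_4) != 0).
Proof.
rewrite /hcoord (_ : (0 : 'I_4) = lshift 2 (0 : 'I_2)); last exact: val_inj.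
rewrite (_ : (1 : 'I_4) = lshift 2 (1 : 'I_2)); last exact: val_inj.
rewrite !row_mxEl -negb_and; apply: contra (vpick_P1_neq0 P.1).
move=> /andP[/eqP h0 /eqP h1]; apply/eqP/rowP => a; rewrite mxE.
by case: a => -[|[|//]] ha; [rewrite -[RHS]h0 | rewrite -[RHS]h1];
  congr (_ _ _); exact: val_inj.
Qed.

Lemma hcoord_y P : (hcoord P 0 (2%:R : 'I_4) != 0) || (hcoord P 0 (3%:R : 'I_4) != 0).
Proof.
rewrite /hcoord (_ : (2%:R : 'I_4) = rshift 2 (0 : 'I_2)); last exact: val_inj.
rewrite (_ : (3%:R : 'I_4) = rshift 2 (1 : 'I_2)); last exact: val_inj.
rewrite !row_mxEr -negb_and; apply: contra (vpick_P1_neq0 P.2).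
move=> /andP[/eqP h0 /eqP h1]; apply/eqP/rowP => a; rewrite mxE.
by case: a => -[|[|//]] ha; [rewrite -[RHS]h0 | rewrite -[RHS]h1];
  congr (_ _ _); exact: val_inj.
Qed.

Lemma eval_atM P f g : eval_at P (f * g) = eval_at P f * eval_at P g.
Proof. exact: mevalM. Qed.

Lemma eval_atX P c : eval_at P ('X_c) = hcoord P 0 c.
Proof. exact: mevalXU. Qed.

Variable X : {fset P1xP1 k}.

(** At each point one of [y_0], [y_1] is not zero. *)
Lemma vanishing_saturated f :
  vanishing X ('X_2%:R * f) -> vanishing X ('X_3%:R * f) -> vanishing X f.
Proof.
move=> /vanishingP h2 /vanishingP h3; apply/vanishingP => r P PX.
have bipX c : bipart (r + vdeg c) ('X_c * f) = 'X_c * bipart r f.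
  by rewrite mulrC (bipartMr _ _ (@bihomogX k c)) addrK mulrC.
have := h2 (r + vdeg 2%:R) P PX; have := h3 (r + vdeg 3%:R) P PX.
rewrite !bipX !eval_atM !eval_atX => /eqP; rewrite mulf_eq0 => /orP[|/eqP//].
move=> e3 /eqP; rewrite mulf_eq0 => /orP[e2|/eqP//].
by have := hcoord_y P; rewrite e2 e3.
Qed.

Lemma vanishing_proper : X != fset0 -> ~~ vanishing X 1.
Proof.
move=> /fset0Pn[P PX]; apply/vanishingP => /(_ 0 P PX)/eqP.
rewrite bipart_id; last by rewrite -mpolyC1; exact: bihomogC.
by rewrite /eval_at meval1 oner_eq0.
Qed.

End PointCoordinates.

(** * Linear syzygies between forms through generic points *)

Section LinearSyzygies.
Variables (k : fieldType) (n : nat) (t : n.-tuple (P1xP1 k)).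
Hypotheses (t_uniq : uniq t) (generic : generic_hilbert (point_set t)).
Hypothesis n_gt0 : (0 < n)%N.

Let I := ideal_of_points (point_set t).

Lemma point_set_neq0 : point_set t != fset0.
Proof. by rewrite -cardfs_gt0 card_point_set. Qed.

Variable F : free_complex k.
Hypothesis res : minimal_free_resolution (coordinate_module (point_set t)) F.

Variables a b : nat.
Hypotheses (nA : (n <= a.+1 * b.+2)%N) (nB : (n <= a.+2 * b.+1)%N).
Let r : int * int := (a.+1%:Z, b.+1%:Z).
(* The differences are the dimensions of the pieces of [I] in the bidegrees
   [(a, b+1)], [(a+1, b)] and [(a+1, b+1)]. *)
Hypothesis few_generators :
  (2 * (a.+1 * b.+2 - n) + 2 * (a.+2 * b.+1 - n) + betti F 1 r <=
   a.+2 * b.+2 - n)%N.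

Let KA := kerev t a b.+1.
Let KB := kerev t a.+1 b.

Let gens := [pred c : 'I_(fc_rank F 1) | fc_shift c == r].

(** Basis vectors of [I_(a,b+1)] times [x_0], [x_1] and of [I_(a+1,b)] times
    [y_0], [y_1] span, together with the minimal generators of bidegree
    [(a+1,b+1)], the space [I_(a+1,b+1)]. If there are few enough generators,
    this family is not larger than the dimension, hence it is free. *)
Lemma no_linear_syzygy q g0 g1 :
  vanishing (point_set t) q -> vanishing (point_set t) g0 ->
  vanishing (point_set t) g1 ->
  bihomog (a%:Z, b.+1%:Z) q -> bihomog (a.+1%:Z, b%:Z) g0 ->
  bihomog (a.+1%:Z, b%:Z) g1 ->
  'X_0%R * q = 'X_2%:R * g0 + 'X_3%:R * g1 -> q = 0.
Proof.
have [D [hD ID lift _]] := ideal_generators res (vanishing_proper point_set_neq0).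
pose mA c := lin1_mx (@mulX k c a b.+1 a.+1 b.+1).
pose mB c := lin1_mx (@mulX k c a.+1 b a.+1 b.+1).
pose G := \matrix_(j < #|gens|) coords a.+1 b.+1 (D (enum_val j)).
pose W := col_mx (col_mx (KA *m mA 0) (KA *m mA 1))
            (col_mx (col_mx (KB *m mB 2%:R) (KB *m mB 3%:R)) G).
have WU m1 m2 m (x : 'M[k]_(m, nforms a.+1 b.+1)) (A : 'M_(m1, _)) (B : 'M_(m2, _)) :
    (x <= A)%MS -> (x <= col_mx A B)%MS.
  by move=> /submx_trans; apply; rewrite -addsmxE addsmxSl.
have WD m1 m2 m (x : 'M[k]_(m, nforms a.+1 b.+1)) (A : 'M_(m1, _)) (B : 'M_(m2, _)) :
    (x <= B)%MS -> (x <= col_mx A B)%MS.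
  by move=> /submx_trans; apply; rewrite -addsmxE addsmxSr.
have spanX c h : bihomog (r - vdeg c) h -> vanishing (point_set t) h ->
    (coords a.+1 b.+1 ('X_c * h) <= W)%MS.
  have toA c' h' : bihomog (a%:Z, b.+1%:Z) h' -> vanishing (point_set t) h' ->
      (coords a.+1 b.+1 ('X_c' * h') <= KA *m mA c')%MS.
    move=> /form_surj[v ->]; rewrite vanishing_kerev => /submxP[w ->].
    by rewrite -[coords _ _ _]/(mulX c' a.+1 b.+1 _) -mul_rV_lin1 -mulmxA submxMl.
  have toB c' h' : bihomog (a.+1%:Z, b%:Z) h' -> vanishing (point_set t) h' ->
      (coords a.+1 b.+1 ('X_c' * h') <= KB *m mB c')%MS.
    move=> /form_surj[v ->]; rewrite vanishing_kerev => /submxP[w ->].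
    by rewrite -[coords _ _ _]/(mulX c' a.+1 b.+1 _) -mul_rV_lin1 -mulmxA submxMl.
  have r_x : r - (1, 0) = (a%:Z, b.+1%:Z).
    by rewrite -[LHS]/(a.+1%:Z - 1, b.+1%:Z - 0) subr0 -addn1 PoszD addrK.
  have r_y : r - (0, 1) = (a.+1%:Z, b%:Z).
    by rewrite -[LHS]/(a.+1%:Z - 0, b.+1%:Z - 1) subr0 -(addn1 b) PoszD addrK.
  case: c => -[|[|[|[|//]]]] hc; rewrite vdegE /= (r_x, r_y) => hh Ih.
  - rewrite (_ : Ordinal hc = 0); last exact: val_inj.
    by apply/WU/WU/toA.
  - rewrite (_ : Ordinal hc = 1); last exact: val_inj.
    by apply/WU/WD/toA.
  - rewrite (_ : Ordinal hc = 2%:R); last exact: val_inj.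
    by apply/WD/WU/WU/toB.
  rewrite (_ : Ordinal hc = 3%:R); last exact: val_inj.
  by apply/WD/WU/WD/toB.
have spanD c w : bihomog (r - fc_shift c) w ->
    (coords a.+1 b.+1 (w * D c) <= W)%MS.
  move=> hw; have [cr|ne] := eqVneq (fc_shift c) r.
    have -> : w = (w@_0%MM)%:MP by apply: bihomog0C; rewrite -{1}cr subrr in hw.
    have cg : c \in gens by rewrite inE cr.
    rewrite mul_mpolyC linearZ /=; apply: scalemx_sub.
    have -> : coords a.+1 b.+1 (D c) = row (enum_rank_in cg c) G.
      by rewrite rowK enum_rankK_in.
    by apply/WD/WD/row_sub.
  apply: (bihomog_maximal_ind (s := r - fc_shift c)
    (P := fun w => (coords a.+1 b.+1 (w * D c) <= W)%MS) _ _ _ hw).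
  - by rewrite mul0r linear0 sub0mx.
  - by move=> f g; rewrite mulrDl linearD; exact: addmx_sub.
  - move=> x h hh; rewrite -mulrA; apply: spanX.
      have -> : r - vdeg x = r - fc_shift c - vdeg x + fc_shift c.
        by rewrite [RHS]addrAC subrK.
      exact: bihomogM.
    by apply: vanishing_mul; exact: ID.
  apply/eqP; apply: contraNT ne => /(bihomog_const hw)/eqP.
  by rewrite subr_eq0 eq_sym.
have span : (kerev t a.+1 b.+1 <= W)%MS.
  apply/row_subP => x; set v := row x _.
  have hv : (v <= kerev t a.+1 b.+1)%MS by exact: row_sub.
  rewrite -vanishing_kerev in hv.
  have [w hw ev] := lift _ _ (@form_bihomog _ _ _ v) hv.
  rewrite -[v]formK ev linear_sum /=; apply: summx_sub => c _; exact: spanD.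
have free : row_free W.
  rewrite /row_free eqn_leq rank_leq_row /=.
  apply: leq_trans (mxrankS span); rewrite eq_row_base.
  have := rank_kerev t_uniq generic nA; have := rank_kerev t_uniq generic nB.
  have nC : (n <= a.+2 * b.+2)%N by apply: leq_trans nA _; rewrite leq_mul2r leqnSn orbT.
  have := rank_kerev t_uniq generic nC.
  move: few_generators; rewrite /betti -/gens.
  set x := \rank _; set y := \rank _; set z := \rank _.
  lia.
move=> Iq I0 I1 /form_surj[v qE] /form_surj[w0 g0E] /form_surj[w1 g1E].
move: Iq I0 I1; rewrite qE g0E g1E !vanishing_kerev.
move=> /submxP[cq ->] /submxP[c0 ->] /submxP[c1 ->] e.
have mulE m i0 i1 (u : 'rV_m) (E : 'M_(m, nforms i0 i1)) c :
    u *m (E *m lin1_mx (@mulX k c i0 i1 a.+1 b.+1)) =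
    coords a.+1 b.+1 ('X_c * form (u *m E)).
  by rewrite mulmxA mul_rV_lin1.
have : row_mx (row_mx cq 0) (row_mx (row_mx (- c0) (- c1)) 0) *m W = 0.
  rewrite /W !mul_row_col !mul0mx !addr0 !mulNmx !mulE.
  by rewrite -/KA -/KB in e *; rewrite e linearD -opprD subrr.
rewrite -[RHS](mul0mx _ W) => /(row_free_inj free) e0.
have /eqP := congr1 (fun M => lsubmx (lsubmx M)) e0.
by rewrite !row_mxKl !linear0 => /eqP ->; rewrite mul0mx linear0.
Qed.

End LinearSyzygies.

(** * Regularity and separating forms *)

Section RegularityOfPoints.
Variables (k : fieldType) (n : nat) (t : n.-tuple (P1xP1 k)).
Hypotheses (t_uniq : uniq t) (generic : generic_hilbert (point_set t)).

Let I := ideal_of_points (point_set t).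

Lemma bihomog_Bgen a : bihomog (1, 1) (Bgen k a).
Proof.
have h c d : vdeg c + vdeg d = (1, 1) -> bihomog (1, 1) ('X_c * 'X_d : cox k).
  by move=> <-; apply: bihomogM; exact: bihomogX.
by case: a => -[|[|[|[|//]]]] ha; apply: h; rewrite !vdegE.
Qed.

Lemma bihomog_BgenX a m : bihomog (m%:Z, m%:Z) (Bgen k a ^+ m).
Proof.
have -> : (m%:Z, m%:Z) = (1, 1) *+ m.
  by elim: m => // m IH; rewrite mulrS -IH -addn1 PoszD addrC.
by apply: bihomog_expn; exact: bihomog_Bgen.
Qed.

Lemma Bgen_neq0 (P : P1xP1 k) : exists a, eval_at P (Bgen k a) != 0.
Proof.
have ev c d : hcoord P 0 c != 0 -> hcoord P 0 d != 0 ->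
    eval_at P ('X_c * 'X_d) != 0.
  by move=> hc hd; rewrite eval_atM !eval_atX mulf_neq0.
case/orP: (hcoord_x P) => hx; case/orP: (hcoord_y P) => hy.
- by exists 0; exact: ev.
- by exists 1; exact: ev.
- by exists 2%:R; exact: ev.
- by exists 3%:R; exact: ev.
Qed.

(** The restriction to the charts of a form [f] vanishing at all points but
    one glue, after rescaling by the values at that point, to a Cech 1-cocycle
    of degree [r]: the function that is 1 at the point and 0 at the others.
    If [H^1_B] vanishes in degree [r], a form of degree [r] represents it. *)
Lemma regular_separating_form r l : regular (coordinate_module (point_set t)) r ->
  exists2 p, bihomog r p & forall l', eval_at (tnth t l') p = (l' == l)%:R.
Proof.
move=> [reg _]; have {}reg : local_cohomology_vanishes (coordinate_module (point_set t)) 1 r.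
  by have := reg 1%N 0%N 0%N 0%N 0%N isT erefl; rewrite subr0 addr0.
(* The exponent makes both coordinates of [r + (T, T)] at least [n]. *)
pose T := (`|r.1| + `|r.2| + n)%N.
have [al eal] : exists al : nat, r.1 + T%:Z = al%:Z /\ (n <= al)%N.
  by exists `|(r.1 + T%:Z)%R|%N; rewrite /T; lia.
have [be ebe] : exists be : nat, r.2 + T%:Z = be%:Z /\ (n <= be)%N.
  by exists `|(r.2 + T%:Z)%R|%N; rewrite /T; lia.
have rT : r + (T%:Z, T%:Z) = (al%:Z, be%:Z).
  by case: (r) eal ebe => r1 r2 [/= <- _] [<- _].
have [|f hf ef] := @separating_form _ _ t t_uniq generic al be l.
  by case: eal ebe => _ h1 [_ h2]; nia.
rewrite -rT in hf.
pose bt a := eval_at (tnth t l) (Bgen k a).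
pose u (A : {set 'I_4}) : coordinate_module (point_set t) :=
  qclass I ((\sum_(a in A) bt a ^+ T)%:MP * f).
have hom_u c : bihomog (r + (T%:Z, T%:Z)) (c%:MP * f).
  by rewrite -[r + _]add0r; apply: bihomogM => //; exact: bihomogC.
have [||s [v [hv hu]]] := reg T u.
- move=> A A1; rewrite A1 muln1.
  by exists ((\sum_(a in A) bt a ^+ T)%:MP * f); first exact: hom_u.
- move=> A /eqP A2; exists 0%N; rewrite !expr0 !scale1r scaler0 subr0 /coboundary.
  under eq_bigr do rewrite qclassZ.
  rewrite -raddf_sum; apply/eqP; rewrite qclass_eq0.
  have hom (a : 'I_4) : bihomog ((T%:Z, T%:Z) + (r + (T%:Z, T%:Z)))
      ((-1) ^+ #|[set b in A | (b < a)%N]| * Bgen k a ^+ T *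
       ((\sum_(b in A :\ a) bt b ^+ T)%:MP * f)).
    apply: bihomogM; last exact: hom_u.
    rewrite -signr_odd mulr_sign.
    by case: odd; [apply: bihomogN|]; exact: bihomog_BgenX.
  rewrite /=; set G := (X in vanishing _ X).
  have homG : bihomog ((T%:Z, T%:Z) + (r + (T%:Z, T%:Z))) G.
    by apply: bihomog_sum => a _; exact: hom.
  apply/(vanishing_homogP t homG) => l'; rewrite /G.
  rewrite /eval_at raddf_sum /=.
  have [->|ne] := eqVneq l' l; last first.
    by rewrite big1 // => a _; rewrite !mevalM [X in _ * (_ * X)]ef (negPf ne) !mulr0.
  have [x [y [lt_xy ->]]] : exists x y : 'I_4, (x < y)%N /\ A = [set x; y].
    case/cards2P: A2 => x [y [ne ->]].
    by case: (ltngtP x y) => [lt|lt|/val_inj e];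
      [exists x, y | exists y, x; rewrite setUC | rewrite e eqxx in ne].
  have ne_xy : x != y by rewrite neq_ltn lt_xy.
  rewrite big_setU1 ?inE //= big_set1 setU1K ?inE // setUC setU1K ?inE 1?eq_sym //.
  have -> : [set b in [set y; x] | (b < x)%N] = set0.
    apply/setP => b; rewrite !inE; case: eqP => [->|_] /=; first by rewrite ltnNge ltnW.
    by case: eqP => //= ->; rewrite ltnn.
  have -> : [set b in [set y; x] | (b < y)%N] = [set x].
    apply/setP => b; rewrite !inE; case: eqP => [->|_] /=; first by rewrite
    ltnn eq_sym (negPf ne_xy).
    by case: eqP => //= ->.
  rewrite cards0 cards1 !big_set1 !mevalM expr0 expr1 mevalN meval1 !mevalC.
  rewrite !(rmorphXn (meval _)) /= -/(eval_at _ _) -/(eval_at _ (Bgen k y)).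
  rewrite -/(bt x) -/(bt y); move: (bt x ^+ T) (bt y ^+ T) (_.@[_]) => c d e.
  by ring.
have [p hp ep] := hv 0%N erefl set0 (cards0 _).
rewrite cards0 muln0 addr0 in hp.
exists p => // l'; have [a a0] := Bgen_neq0 (tnth t l').
have [N] := hu [set a] (cards1 a).
rewrite /coboundary big_set1 setDv ep /u big_set1 /Bprod !big_set1.
have -> : [set b in [set a] | (b < a)%N] = set0.
  by apply/setP => b; rewrite !inE; case: eqP => //= ->; rewrite ltnn.
rewrite cards0 expr0 mul1r (qclassZ _ _ p) !qclassZ -raddfB qclassZ => /eqP.
rewrite qclass_eq0 /=; set G := (X in vanishing _ X).
have homG : bihomog ((N%:Z, N%:Z) + ((s%:Z, s%:Z) + (r + (T%:Z, T%:Z)))) G.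
  apply: bihomogM; first exact: bihomog_BgenX.
  apply: bihomogB; first by apply: bihomogM; [exact: bihomog_BgenX | exact: hom_u].
  have -> : (s%:Z, s%:Z) + (r + (T%:Z, T%:Z)) = (T%:Z, T%:Z) + ((s%:Z, s%:Z) + r).
    by rewrite addrA addrC.
  by apply: bihomogM; [|apply: bihomogM => //]; exact: bihomog_BgenX.
move/(vanishing_homogP t homG)/(_ l')/eqP.
rewrite /G /eval_at mevalM mevalB !mevalM !(rmorphXn (meval _)) /= !mevalC.
rewrite -!/(eval_at _ _) ef; move: a0; set b := eval_at _ (Bgen k a) => b0.
rewrite mulf_eq0 expf_eq0 (negPf b0) andbF /= [X in _ - X]mulrCA -mulrBr.
rewrite mulf_eq0 expf_eq0 (negPf b0) andbF /= subr_eq0 => /eqP.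
have bT : b ^+ T != 0 by rewrite expf_eq0 (negPf b0) andbF.
have [ell|ne] := eqVneq l' l.
  have -> : bt a = b by rewrite /bt /b ell.
  by rewrite mulr1 -{1}[b ^+ T]mulr1 => /(mulfI bT) ->.
rewrite mulr0 => /esym/eqP; rewrite mulf_eq0 (negPf bT) => /eqP //.
Qed.

End RegularityOfPoints.

(** * Second syzygies *)

Section LinearFormsCoprime.
Variable k : fieldType.
Implicit Types (f g h s : cox k) (b : 'I_4).

(** Substitution of [s] for [X_b]; for [s] free of [X_b] this is the quotient
    map modulo [X_b - s]. *)
Definition xsubst b s : cox k -> cox k :=
  comp_mpoly [tuple if a == b then s else 'X_a | a < 4].

Lemma xsubstX b s a : xsubst b s ('X_a) = if a == b then s else 'X_a.
Proof. by rewrite /xsubst comp_mpolyXU -tnth_nth tnth_mktuple. Qed.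

Lemma xsubstM b s : {morph xsubst b s : f g / f * g}.
Proof. exact: rmorphM. Qed.

Lemma xsubst_congr b s f : exists g, f - xsubst b s f = ('X_b - s) * g.
Proof.
pose Q f := exists g, f - xsubst b s f = ('X_b - s) * g.
have Q0 : Q 0 by exists 0; rewrite /xsubst comp_mpoly0 subr0 mulr0.
have Q1 : Q 1 by exists 0; rewrite /xsubst comp_mpoly1 subrr mulr0.
have QD p q : Q p -> Q q -> Q (p + q).
  move=> [u eu] [v ev]; exists (u + v).
  by rewrite mulrDr -eu -ev /xsubst comp_mpolyD opprD addrACA.
have QM p q : Q p -> Q q -> Q (p * q).
  move=> [u eu] [v ev]; exists (u * q + xsubst b s p * v).
  rewrite xsubstM mulrDr mulrA -eu mulrCA -ev.
  by move: (xsubst b s p) (xsubst b s q) => p' q'; ring.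
have QC c : Q c%:MP by exists 0; rewrite /xsubst comp_mpolyC subrr mulr0.
have QX a : Q 'X_a.
  rewrite /Q xsubstX; case: eqP => [->|_]; first by exists 1; rewrite mulr1.
  by exists 0; rewrite subrr mulr0.
rewrite -/(Q f) [f]mpolyE; apply: (big_ind Q Q0 QD) => m _.
rewrite -mul_mpolyC; apply: (QM _ _ (QC _)); rewrite mpolyXE_id.
apply: (big_ind Q Q1 QM) => a _; elim: (m a) => [|j IH]; first by rewrite expr0.
by rewrite exprS; exact: (QM _ _ (QX a) IH).
Qed.

(** Modulo a linear form in [x_0], [x_1] the ring is still a domain, in which a
    nonzero linear form in [y_0], [y_1] does not vanish. *)
Lemma linear_forms_coprime (c0 c1 d0 d1 : k) f h :
  (c0 != 0) || (c1 != 0) -> (d0 != 0) || (d1 != 0) ->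
  (c0 *: 'X_0 + c1 *: 'X_1) * f = (d0 *: 'X_2%:R + d1 *: 'X_3%:R) * h ->
  exists w, h = (c0 *: 'X_0 + c1 *: 'X_1) * w.
Proof.
set l := c0 *: _ + _; set m := d0 *: _ + _ => c_n0 d_n0 e.
have m_n0 : m != 0.
  apply/eqP => m0.
  have := congr1 (mcoeff U_(2%:R)%MM) m0; have := congr1 (mcoeff U_(3%:R)%MM) m0.
  rewrite !mcoeffD !mcoeffZ !mcoeffXU !mcoeff0 /= !(mulr1, mulr0, addr0, add0r).
  by move=> e1 e0; rewrite e1 e0 eqxx in d_n0.
have main b s (u : k) : u != 0 -> l = u *: ('X_b - s) -> xsubst b s l = 0 ->
    xsubst b s m = m -> exists w, h = l * w.
  move=> u0 lE l0 mE; have [g eg] := xsubst_congr b s h.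
  have := congr1 (xsubst b s) e; rewrite !xsubstM l0 mE mul0r.
  move/esym/eqP; rewrite mulf_eq0 (negPf m_n0) => /eqP h0.
  exists (u^-1 *: g); rewrite -[LHS]subr0 -h0 eg lE.
  by rewrite -scalerAl -scalerAr scalerA mulfV // scale1r.
have xsubstL b s (x y : k) a a' : xsubst b s (x *: 'X_a + y *: 'X_a') =
    x *: xsubst b s 'X_a + y *: xsubst b s 'X_a'.
  by rewrite /xsubst comp_mpolyD !comp_mpolyZ.
case/orP: c_n0 => c_n0.
  apply: (main 0 (- (c1 / c0) *: 'X_1) c0 c_n0); rewrite /l /m.
  - by rewrite scalerBr scalerA mulrN mulrCA mulfV // mulr1 scaleNr opprK.
  - by rewrite xsubstL !xsubstX /= scalerA mulrN mulrCA mulfV // mulr1 scaleNr addNr.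
  - by rewrite xsubstL !xsubstX.
apply: (main 1 (- (c0 / c1) *: 'X_0) c1 c_n0); rewrite /l /m.
- by rewrite scalerBr scalerA mulrN mulrCA mulfV // mulr1 scaleNr opprK addrC.
- by rewrite xsubstL !xsubstX /= scalerA mulrN mulrCA mulfV // mulr1 scaleNr addrN.
- by rewrite xsubstL !xsubstX.
Qed.

End LinearFormsCoprime.

Section SecondSyzygies.
Variables (k : fieldType) (n : nat) (t : n.-tuple (P1xP1 k)).
Variable F : free_complex k.
Hypothesis res : minimal_free_resolution (coordinate_module (point_set t)) F.

(** If [p] vanishes at all points except [P] and [l], [m] are linear forms in
    the [x] and in the [y] vanishing at [P], then [m p] and [l p] lie in the ideal
    and [l (m p) - m (l p) = 0] is a syzygy. It is nontrivial, since otherwise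
    dividing it by [l] would put [p] itself in the ideal. *)
Lemma second_syzygy_generator r l p : bihomog r p ->
  (forall l', eval_at (tnth t l') p = (l' == l)%:R) ->
  exists a : 'I_(fc_rank F 2), preceq (fc_shift a) (r + (1, 1)).
Proof.
move=> hp ep; set P := tnth t l.
have neq0 : point_set t != fset0.
  by apply/fset0Pn; exists P; rewrite in_fset mem_tnth.
have [D [_ ID lift relations]] := ideal_generators res (vanishing_proper neq0).
pose lx : cox k := hcoord P 0 (1 : 'I_4) *: 'X_0 + - hcoord P 0 (0 : 'I_4) *: 'X_1.
pose ly : cox k := hcoord P 0 (3%:R : 'I_4) *: 'X_2%:R + - hcoord P 0 (2%:R : 'I_4) *: 'X_3%:R.
have hlx : bihomog (1, 0) lx.
  by apply: bihomogD; apply: bihomogZ;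
    [have := @bihomogX k 0 | have := @bihomogX k 1]; rewrite vdegE.
have hly : bihomog (0, 1) ly.
  by apply: bihomogD; apply: bihomogZ;
    [have := @bihomogX k 2%:R | have := @bihomogX k 3%:R]; rewrite vdegE.
have in_ideal s g : bihomog s g -> eval_at P g = 0 -> vanishing (point_set t) (g * p).
  move=> hg g0; apply/(vanishing_homogP t (bihomogM hg hp)) => l'.
  rewrite eval_atM ep; have [->|_] := eqVneq l' l; last by rewrite mulr0.
  by rewrite -/P g0 mul0r.
have lx0 : eval_at P lx = 0.
  by rewrite /eval_at /lx mevalD !mevalZ -!/(eval_at _ _) !eval_atX mulNr mulrC addrN.
have ly0 : eval_at P ly = 0.
  by rewrite /eval_at /ly mevalD !mevalZ -!/(eval_at _ _) !eval_atX mulNr mulrC addrN.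
have [wx hwx ex] := lift _ _ (bihomogM hlx hp) (in_ideal _ _ hlx lx0).
have [wy hwy ey] := lift _ _ (bihomogM hly hp) (in_ideal _ _ hly ly0).
have [/existsP//|none] := boolP [exists a : 'I_(fc_rank F 2), preceq (fc_shift a) (r + (1, 1))].
(* The lift of the relation to [F_1]; without generators of [F_2] in the range it
   is zero. *)
pose v := lx *: wy - ly *: wx.
have [w2 ew2] : exists w, v = w *m fc_diff F 1.
  apply: relations; under eq_bigr do rewrite !mxE mulrBl -!mulrA.
  by rewrite sumrB -!mulr_sumr -ex -ey; ring.
have v0 : v = 0.
  apply/rowP => c; rewrite [RHS]mxE.
  have hv : bihomog (r + (1, 1) - fc_shift c) (v 0 c).
    rewrite !mxE; apply: bihomogB.
      have -> : r + (1, 1) - fc_shift c = (1, 0) + ((0, 1) + r - fc_shift c).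
        by rewrite !addrA [r + _]addrC.
      exact: bihomogM.
    have -> : r + (1, 1) - fc_shift c = (0, 1) + ((1, 0) + r - fc_shift c).
      by rewrite !addrA [r + _]addrC.
    exact: bihomogM.
  rewrite -(bipart_id hv) ew2 mxE (raddf_sum (bipart _)) big1 // => a _ /=.
  rewrite (bipartMr _ _ (@fc_homog k F 1 a c)).
  suff -> : bipart (r + (1, 1) - fc_shift c - (fc_shift a - fc_shift c)) (w2 0 a) = 0.
    by rewrite mul0r.
  apply: (bihomog_neg _ (@bipart_homog _ _ _)).
  rewrite opprB addrA subrK; move: none; rewrite negb_exists => /forallP/(_ a).
  rewrite /preceq negb_and -!Order.TotalTheory.ltNge /= -subr_lt0 -(subr_lt0 (fc_shift a).2).
  by rewrite !subr_lt0.
have /fin_all_exists[g hg] : forall c, exists g, wx 0 c = lx * g.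
  move=> c; have e : lx * wy 0 c = ly * wx 0 c.
    by have := congr1 (fun M : 'rV_ _ => M 0 c) v0; rewrite !mxE => /subr0_eq.
  apply: (linear_forms_coprime _ _ e); rewrite oppr_eq0 orbC.
    exact: hcoord_x.
  exact: hcoord_y.
have lx_n0 : lx != 0.
  apply/eqP => e0.
  have := congr1 (mcoeff U_(0%R)%MM) e0; have := congr1 (mcoeff U_(1%R)%MM) e0.
  rewrite !mcoeffD !mcoeffZ !mcoeffXU !mcoeff0 /= !(mulr1, mulr0, addr0, add0r).
  by move=> /eqP; rewrite oppr_eq0 => /eqP e1 e2; have := hcoord_x P; rewrite e1 e2 eqxx.
have pE : p = \sum_c g c * D c.
  apply: (mulfI lx_n0); rewrite ex mulr_sumr; apply: eq_bigr => c _.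
  by rewrite hg mulrA.
have /(vanishing_homogP t hp)/(_ l) : vanishing (point_set t) p.
  rewrite pE; apply: (@bih_sum _ (ideal_of_points (point_set t))) => c _.
  by apply: vanishing_mul; exact: ID.
by rewrite ep eqxx => /eqP; rewrite oner_eq0.
Qed.

End SecondSyzygies.

(** * Third syzygies *)

Lemma koszul_acyclic_gt4 (k : fieldType) (F : free_complex k) p j r :
  (4 < j)%N -> koszul_acyclic F p j r.
Proof.
move=> j4 u /khomog_gt_size -> // _; exists 0, 0.
by rewrite mulmx0 mul0mx addr0.
Qed.

Section Numerics.
Variables (k : fieldType) (n : nat) (t : n.-tuple (P1xP1 k)).
Hypotheses (t_uniq : uniq t) (generic : generic_hilbert (point_set t)).

Lemma hilbert_entryE (a b : nat) :
  hilbert_entry (point_set t) a%:Z b%:Z = (minn n (a.+1 * b.+1))%:Z.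
Proof. by rewrite /= generic card_point_set. Qed.

(** The bidegree is [(i, i'+1)] with [i = a+2] and [i' = b+2]. Of the nine values
    of the Hilbert function involved, those at [(i, i'+1)], [(i-1, i'+1)] and
    [(i, i')] are [n] and the other six are numbers of monomials. *)
Lemma hilbert_diff2_corner (a b : nat) :
  (n <= a.+2 * b.+4)%N -> (n <= a.+3 * b.+3)%N ->
  (a.+1 * b.+4 <= n)%N -> (a.+2 * b.+3 <= n)%N -> (a.+3 * b.+2 <= n)%N ->
  hilbert_diff2 (point_set t) a.+2%:Z b.+3%:Z =
  3 * (a.+2 * b.+2)%:Z + 4 * a.+2%:Z + b.+2%:Z - 3 * n%:Z.
Proof.
move=> h1 h2 h3 h4 h5.
have E1 m : m.+1%:Z - 1 = m%:Z by rewrite -addn1 PoszD addrK.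
rewrite /hilbert_diff2 /difference !E1 !hilbert_entryE.
rewrite (minn_idPl h1) (minn_idPl h2) (minn_idPr h3) (minn_idPr h4) (minn_idPr h5).
have h0 : (n <= a.+3 * b.+4)%N by nia.
have h6 : (a.+1 * b.+2 <= n)%N by nia.
have h7 : (a.+2 * b.+2 <= n)%N by nia.
have h8 : (a.+1 * b.+3 <= n)%N by nia.
rewrite (minn_idPl h0) (minn_idPr h6) (minn_idPr h7) (minn_idPr h8).
lia.
Qed.

End Numerics.

Section ThirdSyzygies.
Variables (k : fieldType) (n : nat) (t : n.-tuple (P1xP1 k)).
Hypotheses (t_uniq : uniq t) (n_gt0 : (0 < n)%N).
Hypotheses (generic : generic_hilbert (point_set t))
  (generic1 : generic_generators (point_set t)).
Variable F : free_complex k.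
Hypothesis res : minimal_free_resolution (coordinate_module (point_set t)) F.

Let neq0 := point_set_neq0 t_uniq n_gt0.

Lemma no_third_syzygy_of_no_forms r :
  (r.1 < 2) || (r.2 < 0) || ((r.1 - 1) * (r.2 + 1) <= n%:Z) ->
  koszul_acyclic F 0 3 r.
Proof.
move=> le; apply: (koszul_acyclic3 res (vanishing_proper neq0) (@vanishing_saturated _ _)).
move=> q g0 g1 Iq _ _ hq _ _ _; apply: (no_vanishing_form t_uniq generic _ hq Iq).
have -> : r - (2%:Z, 0) = (r.1 - 2, r.2) by case: (r) => r1 r2; congr pair; rewrite subr0.
by move: le => /=; lia.
Qed.

Lemma betti1_le (r r' : int) : hilbert_diff2 (point_set t) r r' <= 0 ->
  (betti F 1 (r, r'))%:Z <= - hilbert_diff2 (point_set t) r r'.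
Proof.
move=> le; have [yes no] := generic1 res r r'.
by have [/yes ->|/no ->] := classic (generator_entry (point_set t) r r'); rewrite ?oppr_ge0.
Qed.

(** The form [q] of [koszul_acyclic3] now has the bidegree [(i-1, i'+1)], in which
    [I] is not zero, and [x_0 q = y_0 g_0 + y_1 g_1] is a relation between forms of
    bidegrees [(i-1, i'+1)] and [(i, i')]. The second inequality says that the
    second difference in bidegree [(i, i'+1)] is not positive, so that the number
    of minimal generators there leaves no room for such a relation. *)
Lemma no_third_syzygy_corner (i i' : int) :
  0 <= i -> i <= i' -> n%:Z < i * (i' + 2) ->
  - 3 * n%:Z + 3 * i * i' + 4 * i + i' <= 0 ->
  koszul_acyclic F 0 3 (i + 1, i' + 1).
Proof.
move=> i0 ii' gt le.
(* For [i <= 1] the two inequalities contradict each other. *)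
have i2 : 2 <= i by nia.
have [a ea] : exists a : nat, i = a.+2%:Z by exists (`|i - 2|)%N; lia.
have [b eb] : exists b : nat, i' = b.+2%:Z by exists (`|i' - 2|)%N; lia.
move: gt le ii' {i0 i2}; rewrite {}ea {}eb => gt le ab.
have h1 : (n <= a.+2 * b.+4)%N by lia.
have h2 : (n <= a.+3 * b.+3)%N by nia.
have h3 : (a.+1 * b.+4 <= n)%N by nia.
have h4 : (a.+2 * b.+3 <= n)%N by nia.
have h5 : (a.+3 * b.+2 <= n)%N by nia.
have d := hilbert_diff2_corner t_uniq generic h1 h2 h3 h4 h5.
have few := @betti1_le a.+2%:Z b.+3%:Z.
rewrite d in few.
apply: (koszul_acyclic3 res (vanishing_proper neq0) (@vanishing_saturated _ _)).
move=> q g0 g1 Iq I0 I1.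
have -> : (a.+2%:Z + 1, b.+2%:Z + 1) - (2%:Z, 0) = (a.+1%:Z, b.+3%:Z).
  by rewrite -[LHS]/(a.+2%:Z + 1 - 2%:Z, b.+2%:Z + 1 - 0); congr pair; lia.
have -> : (a.+2%:Z + 1, b.+2%:Z + 1) - (1, 1) = (a.+2%:Z, b.+2%:Z).
  by rewrite -[LHS]/(a.+2%:Z + 1 - 1, b.+2%:Z + 1 - 1); congr pair; lia.
move=> hq h0 h1'; apply: (no_linear_syzygy t_uniq generic n_gt0 res h1 h2 _ Iq I0 I1 hq h0 h1').
have := few _; lia.
Qed.

End ThirdSyzygies.

Theorem theorem1p3 (k : closedFieldType) (n : nat)
    (U : n.-tuple (P1xP1 k) -> Prop) (t : n.-tuple (P1xP1 k))
    (F : free_complex k) (i i' : int) :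
  (2 <= n)%N ->
  gmr_locus U -> U t -> uniq t ->
  minimal_free_resolution (coordinate_module (point_set t)) F ->
  minimal_regular (coordinate_module (point_set t)) (i, i') ->
  i <= i' ->
  (i * (i' + 2) <= n%:Z \/
   [/\ n%:Z < i * (i' + 2),
       - 3 * n%:Z + 3 * i * i' + 4 * i + i' <= 0
     & 0 <= 3 * n%:Z - 3 * i * i' - 2 * i - 2 * i']) ->
  complex_length (virtual_resolution F (i, i')) 2.
Proof.
move=> n2 [_ _ gmr] /gmr[generic generic1] t_uniq res [reg _] ii' ab.
have n_gt0 : (0 < n)%N by exact: ltnW.
have [p hp ep] := regular_separating_form t_uniq generic (Ordinal n_gt0) reg.
have [i_ge0 i'_ge0] : 0 <= i /\ 0 <= i'.
  apply/andP; rewrite !Order.TotalTheory.leNgt -negb_or; apply/negP => neg.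
  have := ep (Ordinal n_gt0); rewrite (@bihomog_neg k (i, i') p neg hp) eqxx /eval_at meval0.
  by move/esym/eqP; rewrite oner_eq0.
have neq0 := point_set_neq0 t_uniq n_gt0.
have proper := vanishing_proper neq0.
case: (res) => _ [exact minimal].
split=> [|q q2].
  have [a ha] := second_syzygy_generator res hp ep.
  by apply/card_gt0P; exists a.
apply: eq_card0 => a; rewrite inE; apply/negP => /andP[].
case sa : (fc_shift a) => [s s'] /= s_le s'_le.
suff : koszul_acyclic F 0 q (s, s').
  by move/(koszul_acyclic_no_generator exact minimal a); rewrite sa eqxx.
have [->|q3] := eqVneq q 3%N; last first.
  have [->|q4] := eqVneq q 4%N.
    exact: (koszul_acyclic4 res proper (@vanishing_saturated _ _)).
  by apply: koszul_acyclic_gt4; lia.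
case: ab => [le|[gt le _]].
  by apply: (no_third_syzygy_of_no_forms t_uniq n_gt0 generic res) => /=; nia.
(* Except at the corner [(i+1, i'+1)], the bidegree [(s-2, s')] has at most [n]
   monomials. *)
have [[-> ->]|ne] := eqVneq (s, s') (i + 1, i' + 1).
  exact: (no_third_syzygy_corner t_uniq n_gt0 generic generic1 res).
apply: (no_third_syzygy_of_no_forms t_uniq n_gt0 generic res) => /=.
have [s_lt2|s_ge2] := ltrP s 2 => //=; have [//|s'_ge0] := ltrP s' 0.
have [s_i|i_s] := lerP s i.
  have : (s - 1) * (s' + 1) <= (i - 1) * (i' + 2) by apply: ler_pM; lia.
  lia.
have s'_i' : s' <= i'.
  rewrite Order.TotalTheory.leNgt; apply: contraNN ne => i'_s'.
  by apply/eqP; congr pair; lia.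
have : (s - 1) * (s' + 1) <= i * (i' + 1) by apply: ler_pM; lia.
lia.
Qed.
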